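(* Let $s$ and $t$ be terms of types $\tau_1\to\cdots\to\tau_n\to\tau$ and $\tau$ respectively, and let $\Sigma$ be a set of variables. Then the set $S(\Sigma,s,t)$ defined below is a complete set of nominal abstraction solutions for $s\unrhd t$ on $\Sigma$. Construction of $S(\Sigma,s,t)$: let $c_1,\dots,c_n$ be distinct nominal constants not in $\mathrm{supp}(s\unrhd t)$, with $c_i$ of type $\tau_i$. For each $h\in\Sigma$ of type $\tau'$ let $h'$ be a distinct new variable not in $\Sigma$ of type $\tau_1\to\cdots\to\tau_n\to\tau'$; let $\sigma=\{h'\,c_1\cdots c_n/h\mid h\in\Sigma\}$, $s'=s[\sigma]$, $t'=t[\sigma]$. Let $C=\bigcup_{\vec a}\mathit{CSU}(\lambda\vec b.s',\ \lambda\vec b.\lambda\vec a.t')$, where $\vec a=a_1,\dots,a_n$ ranges over all selections of $n$ distinct nominal constants from $\mathrm{supp}(t)\cup\{c_1,\dots,c_n\}$ with $a_i$ of type $\tau_i$, and $\vec b$ is a listing of all nominal constants in $s'$ and $t'$ not among $\vec a$. Then $S(\Sigma,s,t)=\{\sigma\bullet\rho\mid\rho\in C\}$.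
   Context: Terms are simply typed $\lambda$-terms identified up to $\alpha\beta\eta$-conversion. Constants are partitioned into nominal constants $\mathcal{C}$ (infinitely many at each relevant type) and ordinary constants. $\mathrm{supp}(t)$ is the set of nominal constants in $t$. A permutation $\pi$ is a type-preserving bijection of $\mathcal{C}$ moving finitely many elements, acting on terms by renaming nominal constants. For distinct nominal constants $a_1,\dots,a_k$, $\lambda a_1\dots\lambda a_k.t$ denotes $\lambda y_1\dots\lambda y_k.t'$ with $t'$ obtained from $t$ by replacing each $a_i$ by a fresh variable $y_i$. Substitutions are type-preserving maps from variables to terms that are the identity almost everywhere; $\mathrm{supp}(\theta)$ is the set of nominal constants in the range; $\theta\uparrow\Sigma$ agrees with $\theta$ on $\Sigma$ and is the identity elsewhere. $B[\theta]$ is ordinary capture-avoiding application; $B\langle\theta\rangle=(\pi.B)[\theta]$ where $\pi$ maps $\mathrm{supp}(B)$ outside $\mathrm{supp}(\theta)$. $\pi.\theta$ replaces each $t/x$ in $\theta$ by $(\pi.t)/x$; $\theta\circ\rho$ is the ordinary composition with $B[\theta\circ\rho]=B[\theta][\rho]$; $\theta\bullet\rho=(\pi.\theta)\circ\rho$ for a permutation $\pi$ with $\mathrm{supp}(\pi.\theta)\cap\mathrm{supp}(\rho)=\emptyset$. $\theta\approx\rho$ iff $\theta=\pi.\rho$ for some $\pi$; $\rho\le\theta$ iff $\rho\approx\theta\bullet\sigma$ for some $\sigma$; $\rho\le_\Sigma\theta$ iff $\rho\uparrow\Sigma\le\theta\uparrow\Sigma$. Nominal abstraction: for $s:\tau_1\to\cdots\to\tau_n\to\tau$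 and $t:\tau$, ''$s\unrhd t$ holds'' iff $s$ $\lambda$-converts to $\lambda c_1\dots\lambda c_n.t$ for some distinct nominal constants $c_1,\dots,c_n$. A substitution $\theta$ is a solution to $s\unrhd t$ iff $(s\unrhd t)\langle\theta\rangle$ holds (the substitution applied to the formula $s\unrhd t$ as a whole). A complete set of nominal abstraction solutions of $s$ and $t$ on $\Sigma$ is a set $S$ of substitutions each of which is a solution to $s\unrhd t$, such that for every solution $\rho$ of $s\unrhd t$ there is $\theta\in S$ with $\rho\le_\Sigma\theta$. $\mathit{CSU}(u,v)$ denotes an arbitrary but fixed complete set of higher-order unifiers of $u$ and $v$: a set of substitutions $\rho$ with $u[\rho]$ and $v[\rho]$ $\lambda$-convertible, such that every such unifier is less general than some member of the set.
   Formalization: Proved with mends: Σ is finite and contains the free variables of s and t; unifiers in CSU(u,v) must not use nominal constants of u or v; and ρ ≤_Σ θ compares ρ with an instance of θ↑Σ on the variables of Σ only. Without these the claim is false or σ is not a substitution. *)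

(* Defs.v *)
From HB Require Import structures.
From mathcomp Require Import all_boot.

Set Implicit Arguments.
Unset Strict Implicit.
Unset Printing Implicit Defensive.

Inductive ty (B : Type) : Type :=
| Base of B
| Arr of ty B & ty B.

Fixpoint ty_eq (B : eqType) (s t : ty B) : bool :=
  match s, t with
  | Base b, Base b' => b == b'
  | Arr s1 s2, Arr t1 t2 => ty_eq s1 t1 && ty_eq s2 t2
  | _, _ => false
  end.

Lemma ty_eqP (B : eqType) : Equality.axiom (@ty_eq B).
Proof.
elim=> [b|s1 IH1 s2 IH2] [b'|t1 t2] /=; try by constructor.
  by apply: (iffP eqP) => [->|[]].
by apply: (iffP andP) => [[/IH1-> /IH2->]|[<- <-]] //; split; [apply/IH1|apply/IH2].
Qed.

HB.instance Definition _ (B : eqType) := hasDecEq.Build (ty B) (@ty_eqP B).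

Definition arrs (B : Type) (ts : seq (ty B)) (t : ty B) : ty B :=
  foldr (@Arr B) t ts.

(* Constants are indexed by their type.  A type either carries no nominal
   constants (it is not "relevant") or carries infinitely many. *)
Record signature : Type := Signature {
  base : eqType;
  const : ty base -> Type;
  nom : ty base -> eqType;
  nom_infinite : forall (t : ty base) (a : nom t) (L : seq (nom t)),
    exists b : nom t, b \notin L }.

Definition sty (sg : signature) : eqType := ty (base sg).

Definition var (sg : signature) (t : sty sg) : eqType := nat.

Definition anynom (sg : signature) : eqType := {t : sty sg & nom t}.
Definition anyvar (sg : signature) : eqType := {t : sty sg & var t}.

Definition mknom (sg : signature) (t : sty sg) (a : nom t) : anynom sg :=
  Tagged (fun t : sty sg => nom t) a.
Definition mkvar (sg : signature) (t : sty sg) (x : var t) : anyvar sg :=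
  Tagged (fun t : sty sg => var t) x.

(* Vectors of nominal constants a_1, ..., a_n with a_i of type tau_i. *)
Fixpoint noms (sg : signature) (ts : seq (sty sg)) : Type :=
  match ts with
  | [::] => unit
  | t :: ts' => (nom t * noms ts')%type
  end.

Fixpoint nseq_of (sg : signature) (ts : seq (sty sg)) :
    noms ts -> seq (anynom sg) :=
  match ts with
  | [::] => fun _ => [::]
  | t :: ts' => fun a => mknom a.1 :: nseq_of a.2
  end.

(* Bound variables are typed de Bruijn indices (so alpha-equivalence is
   syntactic equality); free variables are named. *)
Inductive idx (T : Type) : seq T -> T -> Type :=
| I0 G t : idx (t :: G) t
| IS G s t of idx G t : idx (s :: G) t.

Inductive tm (sg : signature) : seq (sty sg) -> sty sg -> Type :=
| Bv G t of idx G t : tm G t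
| Fv G t of var t : tm G t
| Nom G t of nom t : tm G t
| Con G t of const t : tm G t
| Lam G s t of tm (s :: G) t : tm G (Arr s t)
| App G s t of tm G (Arr s t) & tm G s : tm G t.

Arguments Bv {sg G t} _.
Arguments Fv {sg} G {t} _.
Arguments Nom {sg} G {t} _.
Arguments Con {sg} G {t} _.

Definition term (sg : signature) (t : sty sg) : Type := tm (sg := sg) [::] t.

Definition up_idx (T : Type) (G D : seq T) (s : T)
    (r : forall t, idx G t -> idx D t) (t : T) (i : idx (s :: G) t) :
    idx (s :: D) t :=
  match i in idx G' t'
    return (match G' return Type with
            | [::] => unit
            | s' :: G0 => (forall u, idx G0 u -> idx D u) -> idx (s' :: D) t'
            end) with
  | I0 G0 t0 => fun _ => I0 D t0
  | IS G0 s0 t0 j => fun r => IS s0 (r t0 j)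
  end r.

Fixpoint ren (sg : signature) (G : seq (sty sg)) (t : sty sg) (m : tm G t) :
    forall D : seq (sty sg), (forall u, idx G u -> idx D u) -> tm D t :=
  match m with
  | Bv G t i => fun D r => Bv (r t i)
  | Fv G t x => fun D r => Fv D x
  | Nom G t a => fun D r => Nom D a
  | Con G t k => fun D r => Con D k
  | Lam G s t p => fun D r => Lam (ren p (up_idx (s := s) r))
  | App G s t p q => fun D r => App (ren p r) (ren q r)
  end.

Definition wk (sg : signature) (G : seq (sty sg)) (s t : sty sg)
    (m : tm G t) : tm (s :: G) t := ren m (fun u i => IS s i).

Definition up_sub (sg : signature) (G D : seq (sty sg)) (s : sty sg)
    (b : forall u, idx G u -> tm D u) (t : sty sg) (i : idx (s :: G) t) :
    tm (s :: D) t :=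
  match i in idx G' t'
    return (match G' return Type with
            | [::] => unit
            | s' :: G0 => (forall u, idx G0 u -> tm D u) -> tm (s' :: D) t'
            end) with
  | I0 G0 t0 => fun _ => Bv (I0 D t0)
  | IS G0 s0 t0 j => fun b => wk s0 (b t0 j)
  end b.

(* Simultaneous capture-avoiding replacement of the bound-variable indices,
   the free variables and the nominal constants of a term.  Beta-contraction,
   application of substitutions, permutation of nominal constants and
   abstraction over a nominal constant are all instances. *)
Fixpoint inst (sg : signature) (G : seq (sty sg)) (t : sty sg) (m : tm G t) :
    forall D : seq (sty sg),
      (forall u, idx G u -> tm D u) ->
      (forall u : sty sg, var u -> tm D u) ->
      (forall u : sty sg, nom u -> tm D u) -> tm D t :=
  match m with
  | Bv G t i => fun D b f n => b t i
  | Fv G t x => fun D b f n => f t x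
  | Nom G t a => fun D b f n => n t a
  | Con G t k => fun D b f n => Con D k
  | Lam G s t p => fun D b f n =>
      Lam (inst p (up_sub (s := s) b)
             (fun u x => wk s (f u x)) (fun u a => wk s (n u a)))
  | App G s t p q => fun D b f n => App (inst p b f n) (inst q b f n)
  end.

Definition scons (sg : signature) (G : seq (sty sg)) (s : sty sg)
    (q : tm G s) (t : sty sg) (i : idx (s :: G) t) : tm G t :=
  match i in idx G' t'
    return (match G' return Type with
            | [::] => unit
            | s' :: G0 => tm G0 s' -> tm G0 t'
            end) with
  | I0 G0 t0 => fun q => q
  | IS G0 s0 t0 j => fun _ => Bv j
  end q.

Definition beta_sub (sg : signature) (G : seq (sty sg)) (s t : sty sg)
    (p : tm (s :: G) t) (q : tm G s) : tm G t :=
  inst p (scons q) (@Fv sg G) (@Nom sg G).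

(* Lambda-conversion: the congruence generated by beta and eta.  Terms are
   identified up to this relation, so it plays the role of equality below. *)
Inductive conv (sg : signature) :
    forall (G : seq (sty sg)) (t : sty sg), tm G t -> tm G t -> Prop :=
| conv_refl G t (m : tm G t) : conv m m
| conv_sym G t (m p : tm G t) : conv m p -> conv p m
| conv_trans G t (m p q : tm G t) : conv m p -> conv p q -> conv m q
| conv_lam G s t (m p : tm (s :: G) t) : conv m p -> conv (Lam m) (Lam p)
| conv_app G s t (m m' : tm G (Arr s t)) (p p' : tm G s) :
    conv m m' -> conv p p' -> conv (App m p) (App m' p')
| conv_beta G s t (p : tm (s :: G) t) (q : tm G s) :
    conv (App (Lam p) q) (beta_sub p q)
| conv_eta G s t (m : tm G (Arr s t)) :
    conv (Lam (App (wk s m) (Bv (I0 G s)))) m.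

Fixpoint nom_occurs (sg : signature) (a : anynom sg) (G : seq (sty sg))
    (t : sty sg) (m : tm G t) : Prop :=
  match m with
  | Nom _ _ b => mknom b = a
  | Lam _ _ _ p => nom_occurs a p
  | App _ _ _ p q => nom_occurs a p \/ nom_occurs a q
  | _ => False
  end.

Fixpoint var_occurs (sg : signature) (x : anyvar sg) (G : seq (sty sg))
    (t : sty sg) (m : tm G t) : Prop :=
  match m with
  | Fv _ _ y => mkvar y = x
  | Lam _ _ _ p => var_occurs x p
  | App _ _ _ p q => var_occurs x p \/ var_occurs x q
  | _ => False
  end.

(* The nominal constants (resp. free variables) of a term taken up to
   conversion are those occurring in all its representatives; these are the
   ones of its normal form, because reduction never creates occurrences. *)
Definition supp (sg : signature) (t : sty sg) (m : term t) (a : anynom sg) :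
    Prop :=
  forall m' : term t, conv m m' -> nom_occurs a m'.

Definition fv (sg : signature) (t : sty sg) (m : term t) (x : anyvar sg) :
    Prop :=
  forall m' : term t, conv m m' -> var_occurs x m'.

Definition bind_nom (sg : signature) (s : sty sg) (a : nom s) (u : sty sg)
    (b : nom u) : tm [:: s] u :=
  match @eqP (sty sg) s u with
  | ReflectT e =>
      match e in _ = v return nom v -> tm [:: s] v with
      | erefl => fun b' => if b' == a then Bv (I0 [::] s) else Nom [:: s] b'
      end b
  | ReflectF _ => Nom [:: s] b
  end.

Definition lam_nom (sg : signature) (s t : sty sg) (a : nom s) (m : term t) :
    term (sg := sg) (Arr s t) :=
  Lam (inst m (fun u i => Bv (IS s i)) (@Fv sg [:: s]) (bind_nom a)).

Fixpoint lam_noms (sg : signature) (ts : seq (sty sg)) (t : sty sg) :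
    noms ts -> term t -> term (sg := sg) (arrs ts t) :=
  match ts with
  | [::] => fun _ m => m
  | s :: ts' => fun a m => lam_nom a.1 (lam_noms a.2 m)
  end.

Fixpoint app_noms (sg : signature) (ts : seq (sty sg)) (t : sty sg) :
    term (sg := sg) (arrs ts t) -> noms ts -> term t :=
  match ts with
  | [::] => fun m _ => m
  | s :: ts' => fun m a => app_noms (App m (Nom [::] a.1)) a.2
  end.

Record perm (sg : signature) : Type := Perm {
  pfun :> forall t : sty sg, nom t -> nom t;
  perm_bij : forall t : sty sg, bijective (pfun (t := t));
  perm_fin : exists L : seq (anynom sg),
    forall (t : sty sg) (a : nom t), mknom a \notin L -> pfun a = a }.

Definition perm_nom (sg : signature) (pi : perm sg) (a : anynom sg) :
    anynom sg := mknom (pi (tag a) (tagged a)).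

Definition perm_term (sg : signature) (t : sty sg) (pi : perm sg)
    (m : term t) : term t :=
  inst m (@Bv sg [::]) (@Fv sg [::]) (fun u a => Nom [::] (pi u a)).

(* Up to conversion nothing is lost by asking for syntactic identity almost
   everywhere. *)
Record subst (sg : signature) : Type := Subst {
  sfun :> forall t : sty sg, var t -> term t;
  subst_fin : exists L : seq (anyvar sg),
    forall (t : sty sg) (x : var t), mkvar x \notin L -> sfun x = Fv [::] x }.

Definition subst_eq (sg : signature) (th rh : subst sg) : Prop :=
  forall (t : sty sg) (x : var t), conv (th t x) (rh t x).

Definition app_subst (sg : signature) (t : sty sg) (th : subst sg)
    (m : term t) : term t :=
  inst m (@Bv sg [::]) th (@Nom sg [::]).

Definition subst_supp (sg : signature) (th : subst sg) (a : anynom sg) : Prop :=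
  exists (t : sty sg) (x : var t), supp (th t x) a.

Lemma perm_subst_fin (sg : signature) (pi : perm sg) (th : subst sg) :
  exists L : seq (anyvar sg), forall (t : sty sg) (x : var t),
    mkvar x \notin L -> perm_term pi (th t x) = Fv [::] x.
Proof. by have [L HL] := subst_fin th; exists L => t x /HL ->. Qed.

Definition perm_subst (sg : signature) (pi : perm sg) (th : subst sg) :
    subst sg :=
  Subst (sfun := fun t x => perm_term pi (th t x)) (perm_subst_fin pi th).

Lemma comp_fin (sg : signature) (th rh : subst sg) :
  exists L : seq (anyvar sg), forall (t : sty sg) (x : var t),
    mkvar x \notin L -> app_subst rh (th t x) = Fv [::] x.
Proof.
have [L HL] := subst_fin th; have [K HK] := subst_fin rh.
exists (L ++ K) => t x; rewrite mem_cat negb_or => /andP[/HL -> /HK].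
by [].
Qed.

(* Ordinary composition, in diagrammatic order: B[th o rh] = B[th][rh]. *)
Definition comp (sg : signature) (th rh : subst sg) : subst sg :=
  Subst (sfun := fun t x => app_subst rh (th t x)) (comp_fin th rh).

Lemma restrict_fin (sg : signature) (Sigma : seq (anyvar sg)) (th : subst sg) :
  exists L : seq (anyvar sg), forall (t : sty sg) (x : var t),
    mkvar x \notin L ->
    (if mkvar x \in Sigma then th t x else Fv [::] x) = Fv [::] x.
Proof. by exists Sigma => t x /negbTE ->. Qed.

Definition restrict (sg : signature) (Sigma : seq (anyvar sg))
    (th : subst sg) : subst sg :=
  Subst (sfun := fun t x => if mkvar x \in Sigma then th t x else Fv [::] x)
    (restrict_fin Sigma th).

(* ch is a value of the nominal capture-avoiding composition of th and rh,
   which is determined only up to the choice of the permutation. *)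
Definition is_ncomp (sg : signature) (th rh ch : subst sg) : Prop :=
  exists pi : perm sg,
    (forall a : anynom sg, subst_supp (perm_subst pi th) a ->
       ~ subst_supp rh a) /\
    subst_eq ch (comp (perm_subst pi th) rh).

Definition approx (sg : signature) (th rh : subst sg) : Prop :=
  exists pi : perm sg, subst_eq th (perm_subst pi rh).

Definition less_general (sg : signature) (rh th : subst sg) : Prop :=
  exists si ch : subst sg, is_ncomp th si ch /\ approx rh ch.

(* less_general (restrict Sigma rh) (restrict Sigma th), where the two sides
   are compared as substitutions for the variables in Sigma.  Without the
   outer restriction of ch, the instantiating substitution si would have to
   be the identity outside Sigma, so that it could not instantiate the
   variables that th introduces. *)
Definition less_general_on (sg : signature) (Sigma : seq (anyvar sg))
    (rh th : subst sg) : Prop :=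
  exists si ch : subst sg,
    is_ncomp (restrict Sigma th) si ch /\
    approx (restrict Sigma rh) (restrict Sigma ch).

(* The nominal constants of u and v are constants of the unification problem
   that are not available for building the terms of the unifier. *)
Definition is_unifier (sg : signature) (t : sty sg) (u v : term t)
    (rh : subst sg) : Prop :=
  conv (app_subst rh u) (app_subst rh v) /\
  (forall a : anynom sg, supp u a \/ supp v a -> ~ subst_supp rh a).

Definition is_csu (sg : signature) (t : sty sg) (u v : term t)
    (U : subst sg -> Prop) : Prop :=
  (forall rh : subst sg, U rh -> is_unifier u v rh) /\
  (forall rh : subst sg, is_unifier u v rh ->
     exists2 th : subst sg, U th & less_general rh th).

Record nabs (sg : signature) (ts : seq (sty sg)) (t : sty sg) : Type := NAbs {
  nabs_l : term (sg := sg) (arrs ts t);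
  nabs_r : term t }.

Section NominalAbstraction.
Context (sg : signature) (ts : seq (sty sg)) (t : sty sg).
Implicit Types (B : nabs ts t) (pi : perm sg) (th rh : subst sg).

Definition nabs_supp B (a : anynom sg) : Prop :=
  supp (nabs_l B) a \/ supp (nabs_r B) a.

Definition nabs_fv B (x : anyvar sg) : Prop :=
  fv (nabs_l B) x \/ fv (nabs_r B) x.

Definition perm_nabs pi B : nabs ts t :=
  NAbs (perm_term pi (nabs_l B)) (perm_term pi (nabs_r B)).

Definition app_nabs th B : nabs ts t :=
  NAbs (app_subst th (nabs_l B)) (app_subst th (nabs_r B)).

Definition holds B : Prop :=
  exists c : noms ts,
    uniq (nseq_of c) /\ conv (nabs_l B) (lam_noms c (nabs_r B)).

(* B' is a value of the nominal capture-avoiding application of th to B. *)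
Definition is_napp th B B' : Prop :=
  exists pi : perm sg,
    (forall a : anynom sg, nabs_supp B a -> ~ subst_supp th (perm_nom pi a)) /\
    B' = app_nabs th (perm_nabs pi B).

Definition is_solution B th : Prop :=
  exists B' : nabs ts t, is_napp th B B' /\ holds B'.

Definition is_csnas (Sigma : seq (anyvar sg)) B (S : subst sg -> Prop) : Prop :=
  (forall th, S th -> is_solution B th) /\
  (forall rh, is_solution B rh ->
     exists2 th, S th & less_general_on Sigma rh th).

End NominalAbstraction.

(* Variables h' of type tau_1 -> ... -> tau_n -> tau' for h of type tau';
   only their values on Sigma matter. *)
Definition raising (sg : signature) (ts : seq (sty sg)) : Type :=
  forall u : sty sg, var u -> var (sg := sg) (arrs ts u).

Definition raise_any (sg : signature) (ts : seq (sty sg)) (pr : raising ts)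
    (x : anyvar sg) : anyvar sg := mkvar (pr (tag x) (tagged x)).

Definition raising_ok (sg : signature) (ts : seq (sty sg))
    (Sigma : seq (anyvar sg)) (pr : raising ts) : Prop :=
  {in Sigma &, injective (raise_any pr)} /\
  {in Sigma, forall h, raise_any pr h \notin Sigma}.

Lemma raise_subst_fin (sg : signature) (ts : seq (sty sg))
    (Sigma : seq (anyvar sg)) (pr : raising ts) (c : noms ts) :
  exists L : seq (anyvar sg), forall (u : sty sg) (h : var u),
    mkvar h \notin L ->
    (if mkvar h \in Sigma then app_noms (Fv [::] (pr u h)) c else Fv [::] h)
    = Fv [::] h.
Proof. by exists Sigma => u h /negbTE ->. Qed.

(* sigma = { h' c_1 ... c_n / h | h in Sigma } *)
Definition raise_subst (sg : signature) (ts : seq (sty sg))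
    (Sigma : seq (anyvar sg)) (pr : raising ts) (c : noms ts) : subst sg :=
  Subst (sfun := fun u h =>
    if mkvar h \in Sigma then app_noms (Fv [::] (pr u h)) c else Fv [::] h)
    (raise_subst_fin Sigma pr c).

(* a_1, ..., a_n is a selection of distinct nominal constants from
   supp(t) and c_1, ..., c_n. *)
Definition selection (sg : signature) (ts : seq (sty sg)) (u : sty sg)
    (t : term u) (c a : noms ts) : Prop :=
  uniq (nseq_of a) /\
  (forall d : anynom sg, d \in nseq_of a -> supp t d \/ d \in nseq_of c).

Definition is_listing (sg : signature) (bs : seq (sty sg)) (b : noms bs)
    (P : anynom sg -> Prop) : Prop :=
  uniq (nseq_of b) /\ (forall d : anynom sg, d \in nseq_of b <-> P d).

(* lst a is the listing b of the remaining nominal constants. *)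
Definition listings_ok (sg : signature) (ts : seq (sty sg)) (u : sty sg)
    (t : term u) (s' : term (sg := sg) (arrs ts u)) (t' : term u) (c : noms ts)
    (lst : noms ts -> {bs : seq (sty sg) & noms bs}) : Prop :=
  forall a : noms ts, selection t c a ->
    is_listing (projT2 (lst a))
      (fun d => (supp s' d \/ supp t' d) /\ d \notin nseq_of a).

Definition unifier_union (sg : signature)
    (CSU : forall u : sty sg, term u -> term u -> subst sg -> Prop)
    (ts : seq (sty sg)) (u : sty sg)
    (t : term u) (s' : term (sg := sg) (arrs ts u)) (t' : term u) (c : noms ts)
    (lst : noms ts -> {bs : seq (sty sg) & noms bs}) (rh : subst sg) : Prop :=
  exists a : noms ts,
    selection t c a /\
    CSU _ (lam_noms (projT2 (lst a)) s')
          (lam_noms (projT2 (lst a)) (lam_noms a t')) rh.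

(* bullet fixes a value of each nominal capture-avoiding composition. *)
Definition solution_set (sg : signature)
    (CSU : forall u : sty sg, term u -> term u -> subst sg -> Prop)
    (bullet : subst sg -> subst sg -> subst sg)
    (ts : seq (sty sg)) (u : sty sg) (Sigma : seq (anyvar sg))
    (s : term (sg := sg) (arrs ts u)) (t : term u)
    (c : noms ts) (pr : raising ts)
    (lst : noms ts -> {bs : seq (sty sg) & noms bs}) (th : subst sg) : Prop :=
  let sigma := raise_subst Sigma pr c in
  exists rh : subst sg,
    unifier_union CSU t (app_subst sigma s) (app_subst sigma t) c lst rh /\
    subst_eq th (bullet sigma rh).

(* Main.v *)
Require Import Defs.
From Stdlib Require Import Classical ClassicalEpsilon.
From mathcomp Require Import all_boot.

(** Soundness: if [rh] unifies the two abstractions and [th] is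
    [(pi.sigma) o rh], extend [pi] so that all constants of [s'], [t'], [a] and
    [b] are sent away from [rh]; applying both abstractions to the renamed [b]
    then shows that [th] solves the renamed [s |> t].

    Completeness: permute a solution so that the abstracted constants [a] lie
    in [supp t] or among the [c]'s and the solution avoids [supp (s |> t)].
    Writing [th] for the result, [h' := \c. th h] is a unifier; it is an
    instance of some [rh0] of the complete set, and applying that instance
    relation to fresh constants in place of the [c]'s exhibits [th] as an
    instance of [sigma] composed with [rh0]. *)

Set Implicit Arguments.
Unset Strict Implicit.
Unset Printing Implicit Defensive.

(** * Substitution calculus *)

(** Terms matter only modulo [conv], and no normal forms are constructed. Since support means
    occurrence in every representative, a constant is shown to lie outside a support by exhibiting
    one representative without it; such representatives are extracted classically.

    The other difficulty is the management of names. Each nominal application or composition hides a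
    permutation that matters only on a support, so it may be altered elsewhere, and most steps
    consist in choosing a better one. Soundness has to make a single permutation serve both the
    composition that produces [th] and the application of [th] to the nominal abstraction.
    Completeness may pass to a permuted copy of a solution because the order is defined up to
    [approx].

    Raising is needed because a substitution cannot produce constants that the abstractions bind:
    the values reach the [c]'s only as arguments of [h']. Abstracting the [c]'s out of each [th h]
    removes them from the range, which is exactly what lets the abstractions commute with the
    resulting unifier. *)

(** The return type matches on the context, so that case analysis on an index into [s :: G] leaves
    no equation between contexts to be transported along. *)
Lemma idx_case (T : Type) (s : T) (G : seq T)
    (P : forall t, idx (s :: G) t -> Prop) :
  P s (I0 G s) -> (forall t (i : idx G t), P t (IS s i)) ->
  forall t (i : idx (s :: G) t), P t i.
Proof.
move=> H0 HS t i; move: P H0 HS.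
refine (match i as i' in idx G' t' return
  match G' return idx G' t' -> Prop with
  | [::] => fun _ => True
  | s' :: G0 => fun i0 => forall P : (forall t, idx (s' :: G0) t -> Prop),
      P s' (I0 G0 s') -> (forall t (i : idx G0 t), P t (IS s' i)) -> P t' i0
  end i' with I0 _ _ => _ | IS _ _ _ _ => _ end) => P H0 HS //.
Qed.

Lemma idx_nil (T : Type) (t : T) : idx [::] t -> False.
Proof. by move=> i; inversion i. Qed.

Section Calculus.
Context (sg : signature).
Implicit Types (G D : seq (sty sg)) (s t u : sty sg).

Lemma up_sub_ext G D s (b b' : forall u, idx G u -> tm D u) :
  (forall u i, b u i = b' u i) ->
  forall u (i : idx (s :: G) u), up_sub b i = up_sub b' i.
Proof. by move=> H; apply: idx_case => //= u i; rewrite H. Qed.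

Lemma up_idx_ext G D s (b b' : forall u, idx G u -> idx D u) :
  (forall u i, b u i = b' u i) ->
  forall u (i : idx (s :: G) u), up_idx b i = up_idx b' i.
Proof. by move=> H; apply: idx_case => //= u i; rewrite H. Qed.

(** Environments are functions, compared pointwise. Asking for agreement only at the atoms that
    occur is what later allows the images of absent atoms to be changed. *)
Lemma inst_ext_occurs G t (m : tm G t) : forall D
    (b b' : forall u, idx G u -> tm D u)
    (f f' : forall u : sty sg, var u -> tm D u)
    (n n' : forall u : sty sg, nom u -> tm D u),
  (forall u i, b u i = b' u i) ->
  (forall u x, var_occurs (mkvar x) m -> f u x = f' u x) ->
  (forall u a, nom_occurs (mknom a) m -> n u a = n' u a) ->
  inst m b f n = inst m b' f' n'.
Proof.
elim: m => {G t} /=.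
- by move=> G t i D b b' f f' n n' Hb _ _; apply: Hb.
- by move=> G t x D b b' f f' n n' _ Hf _; apply: Hf.
- by move=> G t a D b b' f f' n n' _ _ Hn; apply: Hn.
- by [].
- move=> G s t p IH D b b' f f' n n' Hb Hf Hn; congr Lam; apply: IH.
  + exact: up_sub_ext.
  + by move=> u x /Hf ->.
  + by move=> u a /Hn ->.
- move=> G s t p IHp q IHq D b b' f f' n n' Hb Hf Hn.
  by congr App; [apply: IHp|apply: IHq] => // u x H;
    [apply: Hf|apply: Hn|apply: Hf|apply: Hn]; auto.
Qed.

Lemma inst_ext G t (m : tm G t) D
    (b b' : forall u, idx G u -> tm D u)
    (f f' : forall u : sty sg, var u -> tm D u)
    (n n' : forall u : sty sg, nom u -> tm D u) :
  (forall u i, b u i = b' u i) -> (forall u x, f u x = f' u x) ->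
  (forall u a, n u a = n' u a) -> inst m b f n = inst m b' f' n'.
Proof. by move=> Hb Hf Hn; apply: inst_ext_occurs. Qed.

Lemma ren_ext G t (m : tm G t) : forall D (r r' : forall u, idx G u -> idx D u),
  (forall u i, r u i = r' u i) -> ren m r = ren m r'.
Proof.
elim: m => {G t} //=.
- by move=> G t i D r r' H; rewrite H.
- by move=> G s t p IH D r r' H; congr Lam; apply: IH; apply: up_idx_ext.
- by move=> G s t p IHp q IHq D r r' H; congr App; auto.
Qed.

Lemma ren_ren G t (m : tm G t) : forall D E
    (r : forall u, idx G u -> idx D u) (r' : forall u, idx D u -> idx E u),
  ren (ren m r) r' = ren m (fun u i => r' u (r u i)).
Proof.
elim: m => {G t} //=.
- move=> G s t p IH D E r r'; congr Lam; rewrite IH; apply: ren_ext.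
  exact: idx_case.
- by move=> G s t p IHp q IHq D E r r'; rewrite IHp IHq.
Qed.

Lemma inst_ren G t (m : tm G t) : forall D E (r : forall u, idx G u -> idx D u)
    (b : forall u, idx D u -> tm E u) (f : forall u : sty sg, var u -> tm E u)
    (n : forall u : sty sg, nom u -> tm E u),
  inst (ren m r) b f n = inst m (fun u i => b u (r u i)) f n.
Proof.
elim: m => {G t} //=.
- move=> G s t p IH D E r b f n; congr Lam; rewrite IH; apply: inst_ext => //.
  exact: idx_case.
- by move=> G s t p IHp q IHq D E r b f n; rewrite IHp IHq.
Qed.

Lemma ren_wk G D s t (m : tm G t) (r : forall u, idx G u -> idx D u) :
  ren (wk s m) (up_idx r) = wk s (ren m r).
Proof. by rewrite /wk !ren_ren. Qed.

Lemma ren_inst G t (m : tm G t) : forall D E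
    (b : forall u, idx G u -> tm D u) (f : forall u : sty sg, var u -> tm D u)
    (n : forall u : sty sg, nom u -> tm D u) (r : forall u, idx D u -> idx E u),
  ren (inst m b f n) r =
  inst m (fun u i => ren (b u i) r) (fun u x => ren (f u x) r)
    (fun u a => ren (n u a) r).
Proof.
elim: m => {G t} //=.
- move=> G s t p IH D E b f n r; congr Lam; rewrite IH.
  apply: inst_ext => [|u x|u a]; rewrite ?ren_wk //.
  by apply: idx_case => //= u i; rewrite ren_wk.
- by move=> G s t p IHp q IHq D E b f n r; rewrite IHp IHq.
Qed.

Lemma inst_wk G D s t (m : tm G t) (b : forall u, idx G u -> tm D u)
    (f : forall u : sty sg, var u -> tm D u)
    (n : forall u : sty sg, nom u -> tm D u) :
  inst (wk s m) (up_sub b) (fun u x => wk s (f u x)) (fun u a => wk s (n u a))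
  = wk s (inst m b f n).
Proof. by rewrite /wk inst_ren ren_inst. Qed.

Lemma inst_inst G t (m : tm G t) : forall D E
    (b : forall u, idx G u -> tm D u) (f : forall u : sty sg, var u -> tm D u)
    (n : forall u : sty sg, nom u -> tm D u)
    (b' : forall u, idx D u -> tm E u) (f' : forall u : sty sg, var u -> tm E u)
    (n' : forall u : sty sg, nom u -> tm E u),
  inst (inst m b f n) b' f' n' =
  inst m (fun u i => inst (b u i) b' f' n') (fun u x => inst (f u x) b' f' n')
    (fun u a => inst (n u a) b' f' n').
Proof.
elim: m => {G t} //=.
- move=> G s t p IH D E b f n b' f' n'; congr Lam; rewrite IH.
  apply: inst_ext => [|u x|u a]; rewrite ?inst_wk //.
  by apply: idx_case => //= u i; rewrite inst_wk.
- by move=> G s t p IHp q IHq D E b f n b' f' n'; rewrite IHp IHq.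
Qed.

Lemma inst_id G t (m : tm G t) : inst m (@Bv sg G) (@Fv sg G) (@Nom sg G) = m.
Proof.
elim: m => {G t} //=.
- move=> G s t p IH; congr Lam; rewrite -[RHS]IH; apply: inst_ext => //.
  exact: idx_case.
- by move=> G s t p -> q ->.
Qed.

Lemma ren_as_inst G D t (m : tm G t) (r : forall u, idx G u -> idx D u) :
  ren m r = inst m (fun u i => Bv (r u i)) (@Fv sg D) (@Nom sg D).
Proof. by rewrite -{1}[m]inst_id ren_inst. Qed.

(** Permutation, substitution and the binding of a constant are all instances of [inst], so their
    compatibility with conversion is settled here at once. The beta case holds because instantiating
    a contractum gives the contractum of the instantiated redex. *)
Lemma conv_inst G t (m m' : tm G t) : conv m m' -> forall D
    (b : forall u, idx G u -> tm D u) (f : forall u : sty sg, var u -> tm D u)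
    (n : forall u : sty sg, nom u -> tm D u),
  conv (inst m b f n) (inst m' b f n).
Proof.
elim=> {G t m m'}.
- by move=> *; apply: conv_refl.
- by move=> *; apply: conv_sym.
- move=> G t m p q _ IH1 _ IH2 D b f n; exact: conv_trans (IH1 _ _ _ _) (IH2 _ _ _ _).
- by move=> *; apply: conv_lam.
- by move=> *; apply: conv_app.
- move=> G s t p q D b f n /=.
  have -> : inst (beta_sub p q) b f n =
    beta_sub (inst p (up_sub b) (fun u x => wk s (f u x))
                (fun u a => wk s (n u a))) (inst q b f n).
    have wk_scons u (m : tm D u) : inst (wk s m) (scons (inst q b f n))
        (@Fv sg D) (@Nom sg D) = m by rewrite /wk inst_ren /= inst_id.
    rewrite /beta_sub !inst_inst /=.
    apply: inst_ext => [|u x|u a]; rewrite ?wk_scons //.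
    by apply: idx_case => //= u i; rewrite wk_scons.
  exact: conv_beta.
- move=> G s t m D b f n /=; rewrite inst_wk; exact: conv_eta.
Qed.

Lemma conv_ren G D t (m m' : tm G t) (r : forall u, idx G u -> idx D u) :
  conv m m' -> conv (ren m r) (ren m' r).
Proof. by move=> H; rewrite !ren_as_inst; apply: conv_inst. Qed.

Lemma conv_inst_occurs G t (m : tm G t) : forall D
    (b b' : forall u, idx G u -> tm D u)
    (f f' : forall u : sty sg, var u -> tm D u)
    (n n' : forall u : sty sg, nom u -> tm D u),
  (forall u i, conv (b u i) (b' u i)) ->
  (forall u x, var_occurs (mkvar x) m -> conv (f u x) (f' u x)) ->
  (forall u a, nom_occurs (mknom a) m -> conv (n u a) (n' u a)) ->
  conv (inst m b f n) (inst m b' f' n').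
Proof.
elim: m => {G t} /=.
- by move=> G t i D b b' f f' n n' Hb _ _; apply: Hb.
- by move=> G t x D b b' f f' n n' _ Hf _; apply: Hf.
- by move=> G t a D b b' f f' n n' _ _ Hn; apply: Hn.
- by move=> *; apply: conv_refl.
- move=> G s t p IH D b b' f f' n n' Hb Hf Hn; apply: conv_lam; apply: IH.
  + by apply: idx_case => [|u i] /=; [apply: conv_refl|apply: conv_ren].
  + by move=> u x /Hf; apply: conv_ren.
  + by move=> u a /Hn; apply: conv_ren.
- move=> G s t p IHp q IHq D b b' f f' n n' Hb Hf Hn.
  by apply: conv_app; [apply: IHp|apply: IHq] => // u x H;
    [apply: Hf|apply: Hn|apply: Hf|apply: Hn]; auto.
Qed.

(** * Occurrences, support and free variables *)

Lemma nom_occurs_ren a G t (m : tm G t) : forall D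
    (r : forall u, idx G u -> idx D u), nom_occurs a (ren m r) -> nom_occurs a m.
Proof.
elim: m => {G t} //=.
- by move=> G s t p IH D r /IH.
- by move=> G s t p IHp q IHq D r [/IHp|/IHq]; auto.
Qed.

Lemma nom_occurs_inst a G t (m : tm G t) : forall D
    (b : forall u, idx G u -> tm D u)
    (f : forall u : sty sg, var u -> tm D u)
    (n : forall u : sty sg, nom u -> tm D u),
  nom_occurs a (inst m b f n) ->
  [\/ exists u i, nom_occurs a (b u i),
      exists u (x : var u), nom_occurs a (f u x) |
      exists u d, nom_occurs (mknom d) m /\ nom_occurs a (n u d)].
Proof.
elim: m => {G t} //=.
- by move=> G t i D b f n H; apply: Or31; exists t, i.
- by move=> G t x D b f n H; apply: Or32; exists t, x.
- by move=> G t d D b f n H; apply: Or33; exists t, d.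
- move=> G s t p IH D b f n /IH[[u [i]]|[u [x]]|[u [d [Hd]]]].
  + move: u i; apply: idx_case => //= u i /nom_occurs_ren H.
    by apply: Or31; exists u, i.
  + by move=> /nom_occurs_ren H; apply: Or32; exists u, x.
  + by move=> /nom_occurs_ren H; apply: Or33; exists u, d.
- move=> G s t p IHp q IHq D b f n.
  by move=> [/IHp|/IHq] [H|H|[u [d [Hd H]]]];
    [apply: Or31|apply: Or32|apply: Or33; exists u, d; auto
    |apply: Or31|apply: Or32|apply: Or33; exists u, d; auto].
Qed.

Lemma nom_occurs_finite G t (m : tm G t) :
  exists L : seq (anynom sg), forall a, nom_occurs a m -> a \in L.
Proof.
elim: m => {G t} /=; try by move=> *; exists [::].
- by move=> G t a; exists [:: mknom a] => d <-; rewrite inE.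
- by [].
- move=> G s t p [L HL] q [K HK]; exists (L ++ K) => a.
  by rewrite mem_cat => -[/HL|/HK] ->; rewrite ?orbT.
Qed.

Lemma var_occurs_finite G t (m : tm G t) :
  exists L : seq (anyvar sg), forall a, var_occurs a m -> a \in L.
Proof.
elim: m => {G t} /=; try by move=> *; exists [::].
- by move=> G t a; exists [:: mkvar (t := t) a] => d <-; rewrite inE.
- by [].
- move=> G s t p [L HL] q [K HK]; exists (L ++ K) => a.
  by rewrite mem_cat => -[/HL|/HK] ->; rewrite ?orbT.
Qed.

(** Support and free variables are propositions rather than boolean tests, so finite lists of them
    are cut out classically. *)
Lemma filter_prop (T : eqType) (P : T -> Prop) (L : seq T) :
  exists K : seq T, forall x, x \in K <-> x \in L /\ P x.
Proof.
elim: L => [|x L [K HK]]; first by exists [::] => x; split=> // -[].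
have [Px|nPx] := classic (P x).
- exists (x :: K) => y; rewrite !inE; split.
    by case/orP => [/eqP->|/HK[-> ?]]; rewrite ?eqxx ?orbT.
  by case=> /orP[->//|Hy] Py; apply/orP; right; apply/HK.
- exists K => y; rewrite inE HK; split=> [[-> ?]|]; rewrite ?orbT //.
  by case=> /orP[/eqP->|].
Qed.

Lemma supp_finite t (m : term t) :
  exists L : seq (anynom sg), forall a, a \in L <-> supp m a.
Proof.
have [L HL] := nom_occurs_finite m.
have [K HK] := filter_prop (supp m) L.
exists K => a; rewrite HK; split=> [[]//|H]; split=> //.
by apply: HL; apply: H; apply: conv_refl.
Qed.

Lemma not_supp t (m : term t) a :
  ~ supp m a -> exists2 m', conv m m' & ~ nom_occurs a m'.
Proof.
move=> H; have [m' H'] := not_all_ex_not _ _ H.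
by have [H1 H2] := imply_to_and _ _ H'; exists m'.
Qed.

Lemma not_fv t (m : term t) a :
  ~ fv m a -> exists2 m', conv m m' & ~ var_occurs a m'.
Proof.
move=> H; have [m' H'] := not_all_ex_not _ _ H.
by have [H1 H2] := imply_to_and _ _ H'; exists m'.
Qed.

Lemma supp_conv t (m m' : term t) a : conv m m' -> supp m a -> supp m' a.
Proof. by move=> H Hm p Hp; apply: Hm; apply: conv_trans Hp. Qed.

(* No normal form is needed: an atom outside the support is absent from some
   representative, so its image can be changed freely, and only the finitely
   many atoms occurring in [m] have to be treated this way. *)
Lemma conv_inst_fv t (m : term t) D
    (b : forall u, idx [::] u -> tm D u)
    (f f' : forall u : sty sg, var u -> tm D u)
    (n : forall u : sty sg, nom u -> tm D u) :
  (forall u x, fv m (mkvar x) -> conv (f u x) (f' u x)) ->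
  conv (inst m b f n) (inst m b f' n).
Proof.
have [L HL] := var_occurs_finite m; have [K HK] := filter_prop (fun x => ~ fv m x) L.
move=> Hf.
have {Hf}: forall u x, var_occurs (mkvar x) m -> mkvar x \notin K ->
    conv (f u x) (f' u x).
  move=> u x /HL Hx /negP HxK; apply: Hf; apply: NNPP => H.
  by apply: HxK; apply/HK.
have {HK HL L}: forall x, x \in K -> ~ fv m x by move=> x /HK[].
elim: K f => [|y K IH] f HK Hf.
  by apply: conv_inst_occurs => *; try apply: conv_refl; apply: Hf.
pose f1 u (x : var u) := if mkvar x == y then f' u x else f u x.
have [m' Hm Hy] := not_fv (HK y (mem_head _ _)).
apply: (@conv_trans _ _ _ _ (inst m b f1 n)).
  apply: conv_trans (conv_inst Hm _ _ _) _.
  apply: conv_trans (conv_sym (conv_inst Hm _ _ _)).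
  rewrite (@inst_ext_occurs _ _ m' _ b b f f1 n n) //; first exact: conv_refl.
  by move=> u x Hx; rewrite /f1; case: eqP => // E; case: Hy; rewrite -E.
apply: IH => [x Hx|u x Hx HxK]; first by apply: HK; rewrite inE Hx orbT.
rewrite /f1; case: eqP => [_|E]; first exact: conv_refl.
by apply: Hf => //; rewrite inE negb_or HxK andbT; apply/eqP.
Qed.

Lemma conv_inst_supp t (m : term t) D
    (b : forall u, idx [::] u -> tm D u)
    (f : forall u : sty sg, var u -> tm D u)
    (n n' : forall u : sty sg, nom u -> tm D u) :
  (forall u x, supp m (mknom x) -> conv (n u x) (n' u x)) ->
  conv (inst m b f n) (inst m b f n').
Proof.
have [L HL] := nom_occurs_finite m; have [K HK] := filter_prop (fun x => ~ supp m x) L.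
move=> Hf.
have {Hf}: forall u x, nom_occurs (mknom x) m -> mknom x \notin K ->
    conv (n u x) (n' u x).
  move=> u x /HL Hx /negP HxK; apply: Hf; apply: NNPP => H.
  by apply: HxK; apply/HK.
have {HK HL L}: forall x, x \in K -> ~ supp m x by move=> x /HK[].
elim: K n => [|y K IH] n HK Hf.
  by apply: conv_inst_occurs => *; try apply: conv_refl; apply: Hf.
pose n1 u (x : nom u) := if mknom x == y then n' u x else n u x.
have [m' Hm Hy] := not_supp (HK y (mem_head _ _)).
apply: (@conv_trans _ _ _ _ (inst m b f n1)).
  apply: conv_trans (conv_inst Hm _ _ _) _.
  apply: conv_trans (conv_sym (conv_inst Hm _ _ _)).
  rewrite (@inst_ext_occurs _ _ m' _ b b f f n n1) //; first exact: conv_refl.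
  by move=> u x Hx; rewrite /n1; case: eqP => // E; case: Hy; rewrite -E.
apply: IH => [x Hx|u x Hx HxK]; first by apply: HK; rewrite inE Hx orbT.
rewrite /n1; case: eqP => [_|E]; first exact: conv_refl.
by apply: Hf => //; rewrite inE negb_or HxK andbT; apply/eqP.
Qed.

Lemma conv_inst_agree t (m : term t) D
    (b b' : forall u, idx [::] u -> tm D u)
    (f f' : forall u : sty sg, var u -> tm D u)
    (n n' : forall u : sty sg, nom u -> tm D u) :
  (forall u x, fv m (mkvar x) -> conv (f u x) (f' u x)) ->
  (forall u x, supp m (mknom x) -> conv (n u x) (n' u x)) ->
  conv (inst m b f n) (inst m b' f' n').
Proof.
move=> Hf Hn; apply: conv_trans (conv_inst_fv b n Hf) _.
rewrite (@inst_ext _ _ m _ b b' f' f' n n) //; first exact: conv_inst_supp.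
by move=> u i; case: (idx_nil i).
Qed.

(** If neither source contributes [a], replacing every relevant image by a representative free of
    [a] gives a representative of the whole instance in which [a] does not occur. *)
Lemma supp_inst t (m : term t) (b : forall u, idx [::] u -> term u)
    (f : forall u : sty sg, var u -> term u)
    (n : forall u : sty sg, nom u -> term u) (a : anynom sg) :
  supp (inst m b f n) a ->
  (exists u (x : var u), fv m (mkvar x) /\ supp (f u x) a) \/
  (exists u (d : nom u), supp m (mknom d) /\ supp (n u d) a).
Proof.
move=> Ha; apply: NNPP => /not_or_and[Hf Hn].
(* The absence of [a] is required unconditionally, so that no chosen image can contain it; when [a]
   does lie in the support of [p], a dummy variable serves as [q]. *)
pose avoids u (p q : term u) := (~ supp p a -> conv p q) /\ ~ nom_occurs a q.
pose avoid u (p : term u) := epsilon (inhabits p) (avoids u p).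
have avoidP u (p : term u) : avoids u p (avoid u p).
  apply: (epsilon_spec (inhabits p) (avoids u p)).
  have [H|/not_supp[p' H1 H2]] := classic (supp p a); last first.
    by exists p'; split.
  by exists (Fv (t := u) [::] (0 : nat)); split.
have /nom_occurs_inst : nom_occurs a
    (inst m b (fun u x => avoid u (f u x)) (fun u d => avoid u (n u d))).
  apply: Ha; apply: conv_inst_agree => u x Hx; apply: (avoidP _ _).1 => Hs.
  - by apply: Hf; exists u, x.
  - by apply: Hn; exists u, x.
case=> [[u [i]]|[u [x]]|[u [d [_]]]]; [by case: (idx_nil i)|exact: (avoidP _ _).2..].
Qed.

Lemma supp_Fv u (x : var u) a : ~ supp (Fv (sg := sg) [::] x) a.
Proof. by move=> H; apply: (H _ (conv_refl _)). Qed.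

Lemma supp_Nom u (d : nom u) a : supp (Nom (sg := sg) [::] d) a -> a = mknom d.
Proof. by move=> H; rewrite (H _ (conv_refl _)). Qed.

Lemma supp_App s t (p : term (Arr s t)) (q : term s) a :
  supp (App p q) a -> supp p a \/ supp q a.
Proof.
move=> H; apply: NNPP => /not_or_and[/not_supp[p' Hp np] /not_supp[q' Hq nq]].
by case: (H _ (conv_app Hp Hq)).
Qed.

End Calculus.

(** * Finite permutations of nominal constants *)

Section Permutations.
Context (sg : signature).
Implicit Types (pi tau : perm sg) (d e x : anynom sg) (L M R : seq (anynom sg)).

Lemma mknom_inj (t : sty sg) : injective (@mknom sg t).
Proof. by move=> a b /eqP; rewrite eq_Tagged => /eqP. Qed.

Lemma pfun_inj pi (t : sty sg) : injective (pi t).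
Proof. exact: bij_inj (perm_bij pi t). Qed.

Lemma perm_nom_inj pi : injective (perm_nom pi).
Proof.
move=> [t a] [u b] H; have /= E : t = u by apply: (f_equal tag H).
case: _ / E b H => b H.
by congr Tagged; apply: (@pfun_inj pi); apply: mknom_inj.
Qed.

(** * Swaps, inverses and permutations with prescribed values *)

Definition swap_fun (t : sty sg) (a b : nom t) (u : sty sg) (x : nom u) :
    nom u :=
  match @eqP (sty sg) t u with
  | ReflectT e =>
      match e in _ = v return nom v -> nom v with
      | erefl => fun y => if y == a then b else if y == b then a else y
      end x
  | ReflectF _ => x
  end.

(** On tagged constants the cast along the equality of types disappears. *)
Lemma mknom_swap_fun (t : sty sg) (a b : nom t) (u : sty sg) (x : nom u) :
  mknom (swap_fun a b x) =
  if mknom x == mknom a then mknom b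
  else if mknom x == mknom b then mknom a else mknom x.
Proof.
rewrite /swap_fun; case: eqP => [E|nE].
  case: _ / E x => x; rewrite !eq_Tagged /=.
  by case: (x == a) => //; case: (x == b).
have nx (z : nom t) : (mknom x == mknom z) = false.
  by apply/eqP => /(f_equal tag) /= E; apply: nE.
by rewrite !nx.
Qed.

Lemma swap_fun_invol (t : sty sg) (a b : nom t) (u : sty sg) :
  involutive (@swap_fun t a b u).
Proof.
move=> x; apply: mknom_inj; rewrite !mknom_swap_fun.
case: (mknom x =P mknom a) => [->|/eqP/negbTE Ha].
  by rewrite eqxx; case: eqP => // ->.
case: (mknom x =P mknom b) => [->|/eqP/negbTE Hb]; first by rewrite eqxx.
by rewrite Ha Hb.
Qed.

Lemma swap_fun_fin (t : sty sg) (a b : nom t) : exists L : seq (anynom sg),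
  forall (u : sty sg) (x : nom u), mknom x \notin L -> swap_fun a b x = x.
Proof.
exists [:: mknom a; mknom b] => u x; rewrite !inE negb_or => /andP[Ha Hb].
by apply: mknom_inj; rewrite mknom_swap_fun (negbTE Ha) (negbTE Hb).
Qed.

Definition swap (t : sty sg) (a b : nom t) : perm sg :=
  Perm (fun u => inv_bij (@swap_fun_invol t a b u)) (swap_fun_fin a b).

Lemma swap_ex (a b : anynom sg) : tag a = tag b -> exists pi, forall x,
  perm_nom pi x = if x == a then b else if x == b then a else x.
Proof.
case: a b => [t a] [u b] /= E; case: _ / E b => b.
by exists (swap a b) => -[v x]; apply: mknom_swap_fun.
Qed.

Definition perm_id : perm sg.
exists (fun t (z : nom t) => z); [by move=> t; exists id|by exists [::]].
Defined.

Definition perm_comp tau pi : perm sg.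
exists (fun t (z : nom t) => tau t (pi t z)).
  by move=> t; apply: bij_comp; apply: perm_bij.
have [L HL] := perm_fin tau; have [K HK] := perm_fin pi.
exists (L ++ K) => t a; rewrite mem_cat negb_or => /andP[H1 H2].
by rewrite (HK _ _ H2) HL.
Defined.

(** Bijectivity is a mere existence statement at each type, so a choice is needed to collect the
    inverses into one family. It has finite support because the inverse fixes whatever [pi]
    fixes. *)
Lemma perm_inv_ex pi : exists pi' : perm sg,
  (forall t, cancel (pi t) (pi' t)) /\ (forall t, cancel (pi' t) (pi t)).
Proof.
have inv t : {g : nom t -> nom t | cancel (pi t) g /\ cancel g (pi t)}.
  by apply: constructive_indefinite_description; case: (perm_bij pi t) => g;
    exists g.
have K1 t : cancel (pi t) (sval (inv t)) by case: (inv t) => g [].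
have K2 t : cancel (sval (inv t)) (pi t) by case: (inv t) => g [].
have bij t : bijective (sval (inv t)) by exists (pi t).
have fin : exists L : seq (anynom sg), forall (t : sty sg) (a : nom t),
    mknom a \notin L -> sval (inv t) a = a.
  have [L HL] := perm_fin pi; exists L => t a /HL {1}<-; exact: K1.
by exists (Perm bij fin).
Qed.

(** The constant [d] witnesses that its type carries nominal constants, hence infinitely many; only
    the members of [M] of that type have to be avoided. *)
Lemma fresh_nom d M : exists2 e, tag d = tag e & e \notin M.
Proof.
case: d => t d.
have [L HL] : exists L : seq (nom t), forall b, mknom b \in M -> b \in L.
  elim: M => [|[u x] M [L HL]]; first by exists [::].
  have [E|nE] := eqVneq u t.
    case: _ / E d L HL => d L HL; exists (x :: L) => b; rewrite !inE eq_Tagged /=.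
    by case/orP => [->//|/HL ->]; rewrite orbT.
  exists L => b; rewrite inE => /orP[/eqP/(f_equal tag)/= E|/HL//].
  by rewrite E eqxx in nE.
have [b Hb] := nom_infinite d L; exists (mknom b) => //.
by apply: contra Hb => /HL.
Qed.

(* Built by composing swaps, so that an already placed element is never
   moved again. *)
Lemma perm_extend R (E : seq (anynom sg * anynom sg)) :
  (forall p, p \in E -> tag p.1 = tag p.2) ->
  uniq (unzip1 E) -> uniq (unzip2 E) -> (forall p, p \in E -> p.2 \notin R) ->
  exists pi, (forall x, x \in R -> perm_nom pi x = x) /\
    (forall p, p \in E -> p.1 \notin R -> perm_nom pi p.1 = p.2).
Proof.
elim: E => [|[a b] E IH] Ht /=.
  by move=> *; exists perm_id; split=> // -[].
case/andP=> aE uE /andP[bE uE'] HR.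
have [|//|//||pi [Hfix Hpi]] := IH.
- by move=> p Hp; apply: Ht; rewrite inE Hp orbT.
- by move=> p Hp; apply: HR; rewrite inE Hp orbT.
have [aR|aR] := boolP (a \in R).
  exists pi; split=> // p; rewrite inE => /orP[/eqP->|]; last exact: Hpi.
  by rewrite aR.
have [tau Htau] := @swap_ex (perm_nom pi a) b (Ht (a, b) (mem_head _ _)).
have bR : b \notin R := HR (a, b) (mem_head _ _).
exists (perm_comp tau pi); split=> [x xR|p].
  rewrite -[LHS]/(perm_nom tau (perm_nom pi x)) Htau (inj_eq (@perm_nom_inj pi)).
  case: eqP => [E1|_]; first by rewrite -E1 xR in aR.
  by rewrite Hfix //; case: eqP => // E1; rewrite -E1 xR in bR.
rewrite -[perm_nom _ p.1]/(perm_nom tau (perm_nom pi p.1)) Htau.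
rewrite (inj_eq (@perm_nom_inj pi)) inE => /orP[/eqP->|pE pR] /=.
  by rewrite eqxx.
case: eqP => [E1|_]; first by case/negP: aE; rewrite -E1; apply: map_f.
rewrite Hpi //; case: eqP => // E1.
by case/negP: bE; rewrite -E1; apply: map_f.
Qed.

(** Here, unlike in [perm_extend], the targets are free: an image that falls into [M] is swapped
    with a fresh constant. *)
Lemma perm_fresh R L M : (forall d, d \in L -> d \notin R) ->
  exists pi, (forall x, x \in R -> perm_nom pi x = x) /\
    (forall d, d \in L -> perm_nom pi d \notin M).
Proof.
elim: L => [|d L IH] HL; first by exists perm_id; split=> // -[].
have [|pi [Hfix Hpi]] := IH.
  by move=> x Hx; apply: HL; rewrite inE Hx orbT.
(* Avoiding [M] makes [e] an admissible image, avoiding the images of [L] keeps the constants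
   already placed where they are, and avoiding [R] keeps [R] fixed. *)
have [e Ht] := fresh_nom (perm_nom pi d) (M ++ map (perm_nom pi) L ++ R).
rewrite !mem_cat !negb_or => /and3P[eM eL eR].
have [dM|dM] := boolP (perm_nom pi d \in M); last first.
  by exists pi; split=> // x; rewrite inE => /orP[/eqP->|/Hpi].
have [tau Htau] := swap_ex Ht.
exists (perm_comp tau pi); split=> x.
  move=> xR; rewrite -[LHS]/(perm_nom tau (perm_nom pi x)) Htau.
  rewrite (inj_eq (@perm_nom_inj pi)).
  case: eqP => [E1|_].
    by move: (HL d (mem_head _ _)); rewrite -E1 xR.
  by rewrite Hfix //; case: eqP => // E1; rewrite -E1 xR in eR.
rewrite -[perm_nom _ x]/(perm_nom tau (perm_nom pi x)) Htau.
rewrite inE => /orP[/eqP->|xL]; first by rewrite eqxx.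
case: eqP => // _; case: eqP => [E1|_]; last exact: Hpi.
by case/negP: eL; rewrite -E1; apply: map_f.
Qed.

(** * Permutations acting on typed vectors of nominal constants *)

Fixpoint perm_noms pi (ts : seq (sty sg)) : noms ts -> noms ts :=
  match ts with
  | [::] => fun a => a
  | t :: ts' => fun a => (pi t a.1, perm_noms pi a.2)
  end.

Lemma nseq_of_perm_noms pi (ts : seq (sty sg)) (a : noms ts) :
  nseq_of (perm_noms pi a) = map (perm_nom pi) (nseq_of a).
Proof. by elim: ts a => //= t ts IH a; rewrite IH. Qed.

Lemma uniq_perm_noms pi (ts : seq (sty sg)) (a : noms ts) :
  uniq (nseq_of (perm_noms pi a)) = uniq (nseq_of a).
Proof. by rewrite nseq_of_perm_noms map_inj_uniq //; apply: perm_nom_inj. Qed.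

Lemma nseq_of_inj (ts : seq (sty sg)) : injective (@nseq_of sg ts).
Proof.
elim: ts => [|t ts IH] /=; first by case=> -[].
by move=> [a1 a2] [b1 b2] /= H; have := H; case=> _ /IH ->;
  case: H => /eqP; rewrite -/(mknom a1 == mknom b1) => /eqP/mknom_inj ->.
Qed.

Lemma map_tag_nseq_of (ts : seq (sty sg)) (a : noms ts) :
  map tag (nseq_of a) = ts.
Proof. by elim: ts a => //= t ts IH a; rewrite IH. Qed.

(** Entries of [a] may lie in [R] and then stay fixed. The others go to the entry of [b] at the same
    position, which has the same type because both vectors are typed by [ts]. *)
Lemma perm_extend_noms R (ts : seq (sty sg)) (a b : noms ts) :
  uniq (nseq_of a) -> uniq (nseq_of b) ->
  (forall d, d \in nseq_of b -> d \notin R) ->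
  exists pi, (forall x, x \in R -> perm_nom pi x = x) /\
    (forall i x, i < size ts -> nth x (nseq_of a) i \notin R ->
       perm_nom pi (nth x (nseq_of a) i) = nth x (nseq_of b) i).
Proof.
move=> ua ub Hb.
have sz (e : noms ts) : size (nseq_of e) = size ts.
  by rewrite -{2}(map_tag_nseq_of e) size_map.
have nthE x i : i < size ts -> nth (x, x) (zip (nseq_of a) (nseq_of b)) i =
    (nth x (nseq_of a) i, nth x (nseq_of b) i).
  by move=> _; rewrite nth_zip // !sz.
have mem p : p \in zip (nseq_of a) (nseq_of b) -> exists2 i, i < size ts &
    p = (nth p.1 (nseq_of a) i, nth p.1 (nseq_of b) i).
  move=> /(nthP (p.1, p.1))[i]; rewrite size_zip !sz minnn => Hi E.
  by exists i; rewrite // -nthE.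
have [p Hp||||pi [H1 H2]] := @perm_extend R (zip (nseq_of a) (nseq_of b)).
- have [i Hi ->] := mem p Hp; rewrite /=.
  have nt (e : noms ts) : tag (nth p.1 (nseq_of e) i) = nth (tag p.1) ts i.
    by rewrite -[in RHS](map_tag_nseq_of e) (nth_map p.1) ?sz.
  by rewrite !nt.
- by rewrite unzip1_zip ?sz.
- by rewrite unzip2_zip ?sz.
- by move=> p Hp; have [i Hi ->] := mem p Hp; apply: Hb; rewrite mem_nth ?sz.
exists pi; split=> // i x Hi HR; have := H2 (nth (x, x) (zip (nseq_of a) (nseq_of b)) i).
by rewrite nthE // => -> //; rewrite -nthE //; apply: mem_nth; rewrite size_zip !sz minnn.
Qed.

Lemma perm_map_noms R (ts : seq (sty sg)) (a b : noms ts) :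
  uniq (nseq_of a) -> uniq (nseq_of b) ->
  (forall d, d \in nseq_of a -> d \notin R) ->
  (forall d, d \in nseq_of b -> d \notin R) ->
  exists pi, (forall x, x \in R -> perm_nom pi x = x) /\ perm_noms pi a = b.
Proof.
move=> ua ub Ha Hb; have [pi [H1 H2]] := perm_extend_noms ua ub Hb.
exists pi; split=> //; apply: nseq_of_inj; rewrite nseq_of_perm_noms.
have sz (e : noms ts) : size (nseq_of e) = size ts.
  by rewrite -{2}(map_tag_nseq_of e) size_map.
case E : (nseq_of a) => [|x0 l].
  by have := sz a; rewrite E -(sz b); case: (nseq_of b).
rewrite -E; apply: (@eq_from_nth _ x0); rewrite size_map !sz // => i Hi.
rewrite (nth_map x0) ?sz // H2 //; apply: Ha; apply: mem_nth; by rewrite sz.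
Qed.

End Permutations.

(** * Permutations, substitutions and abstraction over nominal constants *)

Section Actions.
Context (sg : signature).
Implicit Types (pi tau : perm sg) (th rh : subst sg).

Lemma subst_eq_refl th : subst_eq th th.
Proof. by move=> t x; apply: conv_refl. Qed.

Lemma perm_term_subst pi th (t : sty sg) (m : term t) :
  perm_term pi (app_subst th m) = app_subst (perm_subst pi th) (perm_term pi m).
Proof. by rewrite /perm_term /app_subst !inst_inst; apply: inst_ext. Qed.

Lemma perm_term_comp tau pi (t : sty sg) (m : term t) :
  perm_term tau (perm_term pi m) = perm_term (perm_comp tau pi) m.
Proof. by rewrite /perm_term inst_inst; apply: inst_ext. Qed.

Lemma perm_term_id pi (t : sty sg) (m : term t) :
  (forall u a, pi u a = a) -> perm_term pi m = m.
Proof. by move=> H; rewrite -[RHS]inst_id; apply: inst_ext => //= u a; rewrite H. Qed.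

Lemma perm_termK pi pi' (t : sty sg) :
  (forall u, cancel (pi u) (pi' u)) -> cancel (@perm_term sg t pi) (perm_term pi').
Proof. by move=> K m; rewrite perm_term_comp perm_term_id // => u a; apply: K. Qed.

Lemma conv_perm pi (t : sty sg) (m m' : term t) :
  conv m m' -> conv (perm_term pi m) (perm_term pi m').
Proof. by move=> H; apply: conv_inst. Qed.

Lemma conv_perm_agree pi tau (t : sty sg) (m : term t) :
  (forall d, supp m d -> perm_nom pi d = perm_nom tau d) ->
  conv (perm_term pi m) (perm_term tau m).
Proof.
move=> H; apply: conv_inst_agree => [u x _|u a /H]; first exact: conv_refl.
by move/mknom_inj => /= ->; apply: conv_refl.
Qed.

Lemma conv_perm_fix pi (t : sty sg) (m : term t) :
  (forall d, supp m d -> perm_nom pi d = d) -> conv (perm_term pi m) m.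
Proof.
move=> H; rewrite -[X in conv _ X](@perm_term_id (perm_id sg)) //.
by apply: conv_perm_agree => -[u d] /H ->.
Qed.

Lemma supp_perm_term pi (t : sty sg) (m : term t) a :
  supp (perm_term pi m) a -> exists2 d, supp m d & a = perm_nom pi d.
Proof.
case/supp_inst => [[u [x [_ /supp_Fv]]]//|[u [d [Hd /supp_Nom ->]]]].
by exists (mknom d).
Qed.

Lemma supp_perm_nom pi (t : sty sg) (m : term t) d :
  supp m d -> supp (perm_term pi m) (perm_nom pi d).
Proof.
have [pi' [K1 K2]] := perm_inv_ex pi.
rewrite -{1}(perm_termK K1 m) => /supp_perm_term[e He ->].
by rewrite /perm_nom /= K2; case: e He.
Qed.

Lemma app_subst_comp th rh (t : sty sg) (m : term t) :
  app_subst rh (app_subst th m) = app_subst (Defs.comp th rh) m.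
Proof. by rewrite /app_subst inst_inst; apply: inst_ext. Qed.

Lemma conv_app_subst th (t : sty sg) (m m' : term t) :
  conv m m' -> conv (app_subst th m) (app_subst th m').
Proof. by move=> H; apply: conv_inst. Qed.

Lemma conv_app_subst_fv th rh (t : sty sg) (m : term t) :
  (forall u x, fv m (mkvar x) -> conv (th u x) (rh u x)) ->
  conv (app_subst th m) (app_subst rh m).
Proof. by move=> H; apply: conv_inst_agree => // *; apply: conv_refl. Qed.

Lemma supp_app_subst th (t : sty sg) (m : term t) a :
  supp (app_subst th m) a -> supp m a \/ subst_supp th a.
Proof.
case/supp_inst => [[u [x [_ Hx]]]|[u [d [Hd /supp_Nom ->]]]]; [right|by left].
by exists u, x.
Qed.

Lemma subst_supp_eq th rh a :
  subst_eq th rh -> subst_supp th a -> subst_supp rh a.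
Proof. by move=> H [u [x Hx]]; exists u, x; apply: supp_conv Hx. Qed.

Lemma subst_supp_perm pi th a : subst_supp (perm_subst pi th) a ->
  exists2 d, subst_supp th d & a = perm_nom pi d.
Proof.
by move=> [u [x /supp_perm_term[d Hd ->]]]; exists d => //; exists u, x.
Qed.

Lemma subst_supp_perm_nom pi th d :
  subst_supp th d -> subst_supp (perm_subst pi th) (perm_nom pi d).
Proof. by move=> [u [x Hx]]; exists u, x; apply: supp_perm_nom. Qed.

Lemma subst_supp_comp th rh a :
  subst_supp (Defs.comp th rh) a -> subst_supp th a \/ subst_supp rh a.
Proof. by move=> [u [x /supp_app_subst[]]]; [left; exists u, x|right]. Qed.

(** Outside a finite list of variables the value is the variable itself, which has empty support. *)
Lemma subst_supp_finite th :
  exists R : seq (anynom sg), forall a, a \in R <-> subst_supp th a.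
Proof.
have [L HL] := subst_fin th.
have [R HR] : exists R : seq (anynom sg), forall u (x : var u) a,
    mkvar x \in L -> supp (th u x) a -> a \in R.
  elim: L {HL} => [|[t y] L [R HR]]; first by exists [::].
  have [K HK] := supp_finite (th t y); exists (K ++ R) => u x a.
  rewrite inE mem_cat => /orP[/eqP E|Hx Ha]; last by rewrite (HR u x) ?orbT.
  have /= Et : u = t by apply: (f_equal tag E).
  case: _ / Et y E K HK => y /eqP; rewrite eq_Tagged => /eqP /= -> K HK Ha.
  by have /HK -> := Ha.
have [K HK] := filter_prop (subst_supp th) R.
exists K => a; rewrite HK; split=> [[]//|Ha]; split=> //.
case: Ha => u [x Hx]; have [/HR H|/HL E] := boolP (mkvar x \in L); first exact: H.
by rewrite E in Hx; case: (supp_Fv Hx).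
Qed.

(* An equation between substitution instances survives a change of the names
   of the constants that the substitution does not use. *)
Lemma conv_app_subst_perm pi rh (t : sty sg) (p q : term t) :
  (forall d, supp p d \/ supp q d ->
     ~ subst_supp rh d /\ ~ subst_supp rh (perm_nom pi d)) ->
  conv (app_subst rh p) (app_subst rh q) ->
  conv (app_subst rh (perm_term pi p)) (app_subst rh (perm_term pi q)).
Proof.
move=> Hpq Hc; have [R HR] := subst_supp_finite rh.
have [P HP] := supp_finite p; have [Q HQ] := supp_finite q.
(* As [pi] may move constants of [rh], it is replaced by a permutation [tau] that agrees with it on
   the supports of [p] and [q] but fixes the support of [rh]. *)
pose E := [seq (d, perm_nom pi d) | d <- undup (P ++ Q)].
have HE d : d \in P ++ Q -> d \notin R /\ perm_nom pi d \notin R.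
  rewrite mem_cat => Hd; have [|H1 H2] := Hpq d.
    by case/orP: Hd => /[dup] H; [move/HP|move/HQ]; auto.
  by split; apply/negP => /HR.
have u1 : unzip1 E = undup (P ++ Q) by rewrite /unzip1 -map_comp map_id.
have u2 : unzip2 E = map (perm_nom pi) (undup (P ++ Q)) by rewrite /unzip2 -map_comp.
have [p0||||tau [H1 H2]] := @perm_extend sg R E.
- by case/mapP => d _ ->.
- by rewrite u1 undup_uniq.
- by rewrite u2 map_inj_uniq ?undup_uniq //; apply: perm_nom_inj.
- by move=> p0 /mapP[d]; rewrite mem_undup => /HE[_ ?] ->.
have agree d : d \in P ++ Q -> perm_nom tau d = perm_nom pi d.
  move=> Hd; apply: (H2 (d, perm_nom pi d)); last by case: (HE d Hd).
  by apply: map_f; rewrite mem_undup.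
have tau_rh : subst_eq (perm_subst tau rh) rh.
  by move=> u x; apply: conv_perm_fix => d Hd; apply: H1; apply/HR; exists u, x.
(* Since [tau] leaves [rh] unchanged up to conversion, it passes through the application of [rh]. *)
have step (m : term t) : (forall d, supp m d -> d \in P ++ Q) ->
    conv (perm_term tau (app_subst rh m)) (app_subst rh (perm_term pi m)).
  move=> Hm; rewrite perm_term_subst.
  apply: conv_trans (conv_app_subst_fv _) _; first by move=> u x _; apply: tau_rh.
  by apply: conv_app_subst; apply: conv_perm_agree => d /Hm /agree.
apply: conv_trans (step q _); last by move=> d /HQ H; rewrite mem_cat H orbT.
apply: conv_trans (conv_sym (step p _)) _; last exact: conv_perm.
by move=> d /HP H; rewrite mem_cat H.
Qed.

(** * Abstraction over nominal constants *)

Lemma bind_nom_same (s : sty sg) (a : nom s) :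
  bind_nom a a = Bv (I0 [::] s).
Proof.
rewrite /bind_nom; case: eqP => // e.
by rewrite (eq_irrelevance e erefl) eqxx.
Qed.

Lemma bind_nom_other (s u : sty sg) (a : nom s) (b : nom u) :
  mknom b <> mknom a -> bind_nom a b = Nom [:: s] b.
Proof.
rewrite /bind_nom; case: eqP => // e; case: _ / e b => b nba.
by case: eqP => // E; rewrite E in nba.
Qed.

(** A case principle that keeps the cast inside [bind_nom] out of later proofs. *)
Lemma bind_nom_ind (s : sty sg) (a : nom s) (P : forall u, nom u -> tm [:: s] u -> Prop) :
  P s a (Bv (I0 [::] s)) ->
  (forall u (b : nom u), mknom b <> mknom a -> P u b (Nom [:: s] b)) ->
  forall u (b : nom u), P u b (bind_nom a b).
Proof.
move=> H0 H1 u b; have [E|nE] := eqVneq (mknom b) (mknom a); last first.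
  by rewrite bind_nom_other; [apply: H1|]; apply/eqP.
have /= Et : s = u by apply: (f_equal tag (esym E)).
by case: _ / Et b E => b /mknom_inj ->; rewrite bind_nom_same.
Qed.

Lemma conv_lam_nom (s t : sty sg) (a : nom s) (m m' : term t) :
  conv m m' -> conv (lam_nom a m) (lam_nom a m').
Proof. by move=> H; apply: conv_lam; apply: conv_inst. Qed.

Lemma app_lam_nom (s t : sty sg) (a : nom s) (m : term t) :
  conv (App (lam_nom a m) (Nom [::] a)) m.
Proof.
apply: conv_trans (conv_beta _ _) _.
rewrite /beta_sub inst_inst /=.
rewrite (@inst_ext _ _ _ m _ _ (@Bv sg [::]) _ (@Fv sg [::]) _ (@Nom sg [::])) //.
  by rewrite inst_id; apply: conv_refl.
exact: (bind_nom_ind (P := fun u b p => inst p _ _ _ = Nom [::] b)).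
Qed.

Lemma supp_lam_nom (s t : sty sg) (a : nom s) (m : term t) d :
  supp (lam_nom a m) d -> supp m d /\ d <> mknom a.
Proof.
have occ (m' : term t) : nom_occurs d (lam_nom a m') ->
    nom_occurs d m' /\ d <> mknom a.
  case/nom_occurs_inst => [[u [i]]//|[u [x]]//|[u [b []]]].
  move: u b; apply: (bind_nom_ind (P := fun u b p => nom_occurs (mknom b) m' ->
    nom_occurs d p -> _)) => //= u b nba Hb E.
  by rewrite -E.
move=> H; split; last by case: (occ _ (H _ (conv_refl _))).
by move=> m' Hm; case: (occ _ (H _ (conv_lam_nom a Hm))).
Qed.

Lemma perm_lam_nom pi (s t : sty sg) (a : nom s) (m : term t) :
  perm_term pi (lam_nom a m) = lam_nom (pi s a) (perm_term pi m).
Proof.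
rewrite /perm_term /lam_nom /=; congr Lam; rewrite !inst_inst /=.
apply: inst_ext => //.
apply: (bind_nom_ind (P := fun u b p => inst p _ _ _ = bind_nom _ (pi u b)))
  => [|u b nba] /=; first by rewrite bind_nom_same.
rewrite bind_nom_other // => H; apply: nba.
exact: (@perm_nom_inj _ pi (mknom b) (mknom a)).
Qed.

(** Binding [a] leaves the values of [th] alone because [a] is not in their support. This is only a
    conversion: a value may still mention [a] syntactically. *)
Lemma app_subst_lam_nom th (s t : sty sg) (a : nom s) (m : term t) :
  ~ subst_supp th (mknom a) ->
  conv (app_subst th (lam_nom a m)) (lam_nom a (app_subst th m)).
Proof.
move=> Ha; rewrite /app_subst /lam_nom /=; apply: conv_lam; rewrite !inst_inst /=.
apply: conv_inst_agree => [u x _ /=|u b _].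
  rewrite /wk ren_as_inst; apply: conv_inst_agree => [v y _|v b Hb].
    exact: conv_refl.
  rewrite bind_nom_other; first exact: conv_refl.
  by move=> E; apply: Ha; rewrite -E; exists u, x.
move: u b; apply: (bind_nom_ind (P := fun u b p =>
  conv (inst p _ _ _) (bind_nom a b))) => [|u b nba] /=.
  by rewrite bind_nom_same; apply: conv_refl.
by rewrite bind_nom_other //; apply: conv_refl.
Qed.

Lemma conv_lam_noms (ts : seq (sty sg)) (t : sty sg) (a : noms ts)
    (m m' : term t) : conv m m' -> conv (lam_noms a m) (lam_noms a m').
Proof.
by move=> H; elim: ts a => //= s ts IH a; apply: conv_lam_nom.
Qed.

Lemma conv_app_noms (ts : seq (sty sg)) (t : sty sg) (a : noms ts)
    (m m' : term (sg := sg) (arrs ts t)) :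
  conv m m' -> conv (app_noms m a) (app_noms m' a).
Proof.
elim: ts m m' a => //= s ts IH m m' a H; apply: IH.
by apply: conv_app => //; apply: conv_refl.
Qed.

Lemma app_lam_noms (ts : seq (sty sg)) (t : sty sg) (a : noms ts) (m : term t) :
  conv (app_noms (lam_noms a m) a) m.
Proof.
elim: ts a => /= [_|s ts IH a]; first exact: conv_refl.
exact: conv_trans (conv_app_noms _ (app_lam_nom _ _)) (IH _).
Qed.

(** Applying both sides to the abstracted constants undoes the abstraction. *)
Lemma lam_noms_inj (ts : seq (sty sg)) (t : sty sg) (a : noms ts)
    (m m' : term t) : conv (lam_noms a m) (lam_noms a m') -> conv m m'.
Proof.
move=> H; apply: conv_trans (app_lam_noms a m').
exact: conv_trans (conv_sym (app_lam_noms a m)) (conv_app_noms _ H).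
Qed.

Lemma supp_lam_noms (ts : seq (sty sg)) (t : sty sg) (a : noms ts)
    (m : term t) d : supp (lam_noms a m) d -> supp m d /\ d \notin nseq_of a.
Proof.
elim: ts a => //= s ts IH a /supp_lam_nom[/IH[H1 H2] H3]; split=> //.
by rewrite inE negb_or H2 andbT; apply/eqP.
Qed.

Lemma perm_lam_noms pi (ts : seq (sty sg)) (t : sty sg) (a : noms ts)
    (m : term t) :
  perm_term pi (lam_noms a m) = lam_noms (perm_noms pi a) (perm_term pi m).
Proof. by elim: ts a => //= s ts IH a; rewrite perm_lam_nom IH. Qed.

Lemma app_subst_lam_noms th (ts : seq (sty sg)) (t : sty sg) (a : noms ts)
    (m : term t) : (forall d, d \in nseq_of a -> ~ subst_supp th d) ->
  conv (app_subst th (lam_noms a m)) (lam_noms a (app_subst th m)).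
Proof.
elim: ts a => /= [_ _|s ts IH a Ha]; first exact: conv_refl.
apply: conv_trans (app_subst_lam_nom _ (Ha _ (mem_head _ _))) _.
by apply: conv_lam_nom; apply: IH => d Hd; apply: Ha; rewrite inE Hd orbT.
Qed.

Lemma perm_app_noms pi (ts : seq (sty sg)) (t : sty sg) (a : noms ts)
    (m : term (sg := sg) (arrs ts t)) :
  perm_term pi (app_noms m a) = app_noms (perm_term pi m) (perm_noms pi a).
Proof. by elim: ts m a => //= s ts IH m a; rewrite IH. Qed.

Lemma app_subst_app_noms th (ts : seq (sty sg)) (t : sty sg) (a : noms ts)
    (m : term (sg := sg) (arrs ts t)) :
  app_subst th (app_noms m a) = app_noms (app_subst th m) a.
Proof. by elim: ts m a => //= s ts IH m a; rewrite IH. Qed.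

Lemma supp_app_noms (ts : seq (sty sg)) (t : sty sg) (a : noms ts)
    (m : term (sg := sg) (arrs ts t)) d :
  supp (app_noms m a) d -> supp m d \/ d \in nseq_of a.
Proof.
elim: ts m a => /= [|s ts IH] m a; first by left.
case/IH => [/supp_App[|/supp_Nom ->]|H]; [by left|right|right].
  exact: mem_head.
by rewrite inE H orbT.
Qed.

End Actions.

(** * Raising and the two halves of the theorem *)

Section Solutions.
Context (sg : signature).
Implicit Types (pi tau : perm sg) (th rh ch : subst sg).

(* [perm_subst pi th] depends only on [pi] over [subst_supp th], so the rest
   of [L] may be sent away from [rh]. *)
Lemma is_ncomp_fresh th rh ch (L : seq (anynom sg)) :
  is_ncomp th rh ch -> exists pi,
    (forall d, d \in L -> ~ subst_supp rh (perm_nom pi d)) /\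
    subst_eq ch (Defs.comp (perm_subst pi th) rh).
Proof.
move=> [pi [Hpi Hch]].
have [S HS] := subst_supp_finite th; have [R HR] := subst_supp_finite rh.
have [d|tau [Hfix Hfr]] := @perm_fresh sg (map (perm_nom pi) S)
    (map (perm_nom pi) [seq d <- L | d \notin S]) R.
  case/mapP => e; rewrite mem_filter => /andP[eS _] ->.
  by rewrite (mem_map (@perm_nom_inj _ pi)).
exists (perm_comp tau pi); split=> [d dL|u x].
  rewrite -[perm_nom _ d]/(perm_nom tau (perm_nom pi d)).
  have [dS|dS] := boolP (d \in S).
    rewrite Hfix; last exact: map_f.
    by apply: Hpi; apply: subst_supp_perm_nom; apply/HS.
  by move/HR; apply/negP; apply: Hfr; apply: map_f; rewrite mem_filter dS.
apply: conv_trans (Hch u x) _; apply: conv_app_subst; apply: conv_perm_agree.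
move=> d Hd; rewrite -[RHS]/(perm_nom tau (perm_nom pi d)) Hfix //.
by apply: map_f; apply/HS; exists u, x.
Qed.

(** * Substitutions with prescribed values on raised variables *)

Definition update_fun (t : sty sg) (x : var t) (m : term t)
    (th : forall u : sty sg, var u -> term u) (u : sty sg) (y : var u) : term u :=
  match @eqP (sty sg) t u with
  | ReflectT e =>
      match e in _ = v return var v -> term v -> term v with
      | erefl => fun z p => if z == x then m else p
      end y (th u y)
  | ReflectF _ => th u y
  end.

Lemma update_fun_same (t : sty sg) (x : var t) (m : term t)
    (th : forall u : sty sg, var u -> term u) : update_fun x m th x = m.
Proof.
rewrite /update_fun; case: eqP => // e.
by rewrite (eq_irrelevance e erefl) eqxx.
Qed.

Lemma update_fun_other (t : sty sg) (x : var t) (m : term t)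
    (th : forall u : sty sg, var u -> term u) (u : sty sg) (y : var u) :
  mkvar y <> mkvar x -> update_fun x m th y = th u y.
Proof.
rewrite /update_fun; case: eqP => // e; case: _ / e y => y nyx.
by case: eqP => // E; case: nyx; rewrite E.
Qed.

Lemma update_ex (t : sty sg) (x : var t) (m : term t) th : exists rh,
  rh t x = m /\
  (forall u (y : var u), mkvar y <> mkvar x -> rh u y = th u y).
Proof.
have fin : exists L : seq (anyvar sg), forall (u : sty sg) (y : var u),
    mkvar y \notin L -> update_fun x m th y = Fv [::] y.
  have [L HL] := subst_fin th; exists (mkvar x :: L) => u y.
  rewrite inE negb_or => /andP[/eqP nyx /HL <-]; exact: update_fun_other.
exists (Subst fin); split=> [|u y]; [exact: update_fun_same|exact: update_fun_other].
Qed.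

Lemma tagged_var_transport (x y : anyvar sg) (P : forall u : sty sg, var u -> Prop) :
  x = y -> P _ (tagged x) -> P _ (tagged y).
Proof. by move=> ->. Qed.

(** The substitution is built by one update per member of [Sigma]; injectivity of raising keeps an
    update from overwriting another. All other variables are left alone, so every constant of the
    range comes from a value of [g]. *)
Lemma raised_subst_ex (ts : seq (sty sg)) (pr : raising ts)
    (g : forall u : sty sg, var u -> term (sg := sg) (arrs ts u))
    (Sigma : seq (anyvar sg)) :
  {in Sigma &, injective (raise_any pr)} ->
  exists rh, (forall u (h : var u), mkvar h \in Sigma -> rh _ (pr u h) = g u h) /\
    (forall d, subst_supp rh d -> exists u (h : var u), supp (g u h) d).
Proof.
elim: Sigma => [|[t x] Sigma IH] inj.
  have fin : exists L : seq (anyvar sg), forall (t : sty sg) (x : var t),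
      mkvar x \notin L -> Fv [::] x = Fv [::] x by exists [::].
  by exists (Subst fin); split=> // d [u [y /supp_Fv]].
have [|rh [H1 H2]] := IH.
  by move=> y z Hy Hz; apply: inj; rewrite inE ?Hy ?Hz orbT.
have [rh' [H3 H4]] := update_ex (pr t x) (g t x) rh.
exists rh'; split=> [u h Hh|d [u [y]]].
  have [E|/eqP nE] := eqVneq (mkvar h) (mkvar x).
    by apply: (@tagged_var_transport (mkvar x) (mkvar h)
                 (fun u h => rh' _ (pr u h) = g u h)).
  rewrite H4.
    by apply: H1; move: Hh; rewrite inE => /orP[/eqP|].
  by move=> E; apply: nE; apply: (inj _ _ Hh (mem_head _ _) E).
have [E|/eqP nE] := eqVneq (mkvar y) (mkvar (pr t x)).
  apply: (@tagged_var_transport (mkvar (pr t x)) (mkvar y) (fun u y => supp (rh' u y) d -> _)) => //=.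
  by rewrite H3 => Hd; exists t, x.
by rewrite H4 // => Hd; apply: H2; exists u, y.
Qed.

Lemma raise_subst_supp (ts : seq (sty sg)) (Sigma : seq (anyvar sg))
    (pr : raising ts) (c : noms ts) d :
  subst_supp (raise_subst Sigma pr c) d -> d \in nseq_of c.
Proof.
move=> [u [x]] /=; case: ifP => _; last by move/supp_Fv.
by case/supp_app_noms => [/supp_Fv|].
Qed.

(** * Soundness *)

Lemma solution_of_unifier (ts bs : seq (sty sg)) (t0 : sty sg)
    (s : term (sg := sg) (arrs ts t0)) (t : term t0) (sigma rh th : subst sg)
    (a : noms ts) (b : noms bs) :
  uniq (nseq_of a) ->
  (forall d, subst_supp sigma d -> ~ nabs_supp (NAbs s t) d) ->
  is_unifier (lam_noms b (app_subst sigma s))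
    (lam_noms b (lam_noms a (app_subst sigma t))) rh ->
  is_ncomp sigma rh th -> is_solution (NAbs s t) th.
Proof.
move=> ua Hsigma [Hconv Hfresh] Hth.
have [Ls HLs] := supp_finite s; have [Lt HLt] := supp_finite t.
have [S HS] := subst_supp_finite sigma.
have [pi [Hpi Heq]] := is_ncomp_fresh (Ls ++ Lt ++ S ++ nseq_of a ++ nseq_of b) Hth.
have Hs d : supp s d -> ~ subst_supp rh (perm_nom pi d).
  by move/HLs => H; apply: Hpi; rewrite mem_cat H.
have Ht d : supp t d -> ~ subst_supp rh (perm_nom pi d).
  by move/HLt => H; apply: Hpi; rewrite !mem_cat H orbT.
have HSi d : subst_supp sigma d -> ~ subst_supp rh (perm_nom pi d).
  by move/HS => H; apply: Hpi; rewrite !mem_cat H !orbT.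
have Ha d : d \in nseq_of (perm_noms pi a) -> ~ subst_supp rh d.
  rewrite nseq_of_perm_noms => /mapP[e He ->].
  by apply: Hpi; rewrite !mem_cat He !orbT.
have Hb d : d \in nseq_of (perm_noms pi b) -> ~ subst_supp rh d.
  rewrite nseq_of_perm_noms => /mapP[e He ->].
  by apply: Hpi; rewrite !mem_cat He !orbT.
exists (app_nabs th (perm_nabs pi (NAbs s t))); split.
  (* A constant of [th] comes from the renamed [sigma] or from [rh]. The first kind cannot meet the
     renamed nominal abstraction since [sigma] avoids the original one and [pi] is injective; the
     second kind is excluded by the choice of [pi]. *)
  exists pi; split=> // d Hd /(subst_supp_eq Heq) /subst_supp_comp[].
    by case/subst_supp_perm => e He /perm_nom_inj E; apply: (Hsigma e) => //; rewrite -E.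
  by case: Hd; [apply: Hs|apply: Ht].
exists (perm_noms pi a); split; first by rewrite uniq_perm_noms.
(* The same [pi] occurs in the composition and in the application, so it can be pulled out of both:
   [th] on the renamed [m] is [rh] on the renamed [m[sigma]]. *)
have act u (m : term u) : conv (app_subst th (perm_term pi m))
    (app_subst rh (perm_term pi (app_subst sigma m))).
  rewrite perm_term_subst app_subst_comp.
  by apply: conv_app_subst_fv => v x _; apply: Heq.
apply: conv_trans (act _ s) _.
apply: conv_trans (conv_lam_noms _ (conv_sym (act _ t))).
(* Abstracting over the renamed [b] as well turns the goal into the [pi]-renaming of the unification
   equation, to which [conv_app_subst_perm] applies. *)
apply: (@lam_noms_inj _ _ _ (perm_noms pi b)).
apply: conv_trans (conv_sym (app_subst_lam_noms _ Hb)) _.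
apply: conv_trans (conv_lam_noms _ (app_subst_lam_noms _ Ha)).
apply: conv_trans (app_subst_lam_noms _ Hb).
rewrite -!perm_lam_noms; apply: conv_app_subst_perm Hconv => d Hd.
split; first exact: Hfresh.
case: Hd => [/supp_lam_noms[]|/supp_lam_noms[/supp_lam_noms[]]] /supp_app_subst[];
  by [move=> /Hs|move=> /Ht|move=> /HSi].
Qed.

(** * Completeness *)

Lemma perm_noms_comp tau pi (ts : seq (sty sg)) (a : noms ts) :
  perm_noms (perm_comp tau pi) a = perm_noms tau (perm_noms pi a).
Proof. by elim: ts a => //= t ts IH a; rewrite IH. Qed.

Lemma approx_perm pi th : approx th (perm_subst pi th).
Proof.
have [pi' [K _]] := perm_inv_ex pi; exists pi' => u x /=.
by rewrite (perm_termK K); apply: conv_refl.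
Qed.

Lemma approx_trans th rh ch : approx th rh -> approx rh ch -> approx th ch.
Proof.
move=> [pi H1] [tau H2]; exists (perm_comp pi tau) => u x.
apply: conv_trans (H1 u x) _; rewrite /= -perm_term_comp.
exact: conv_perm.
Qed.

Lemma approx_restrict (Sigma : seq (anyvar sg)) th rh :
  approx th rh -> approx (restrict Sigma th) (restrict Sigma rh).
Proof.
by move=> [pi H]; exists pi => u x /=; case: ifP => _; [apply: H|apply: conv_refl].
Qed.

Lemma solution_selection (ts : seq (sty sg)) (t0 : sty sg)
    (s : term (sg := sg) (arrs ts t0)) (t : term t0) (c : noms ts) rh :
  uniq (nseq_of c) -> (forall d, d \in nseq_of c -> ~ nabs_supp (NAbs s t) d) ->
  is_solution (NAbs s t) rh ->
  exists th (a : noms ts), [/\ approx rh th, selection t c a,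
    conv (app_subst th s) (lam_noms a (app_subst th t)) &
    forall d, nabs_supp (NAbs s t) d -> ~ subst_supp th d].
Proof.
move=> uc Hc [B [[pi [Hpi ->]] [e [ue He]]]].
have [pi' [K1 K2]] := perm_inv_ex pi.
(* Undoing the permutation hidden in the nominal application gives an equation about [s] and [t]
   themselves, and makes the substitution avoid their supports. *)
pose r1 := perm_subst pi' rh; pose e1 := perm_noms pi' e.
have {}He : conv (app_subst r1 s) (lam_noms e1 (app_subst r1 t)).
  have := conv_perm pi' He.
  by rewrite perm_lam_noms /= !perm_term_subst !(perm_termK K1).
have ue1 : uniq (nseq_of e1) by rewrite uniq_perm_noms.
have Hr1 d : nabs_supp (NAbs s t) d -> ~ subst_supp r1 d.
  move=> Hd /subst_supp_perm[x Hx E]; apply: (Hpi d Hd).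
  by rewrite E /perm_nom /= K2; case: x Hx {E}.
have [Ls HLs] := supp_finite s; have [Lt HLt] := supp_finite t.
have [R1 HR1] := subst_supp_finite r1.
(* The abstracted constants that occur neither in [t] nor in [r1] are
   vacuous, hence can be renamed away from [s]. *)
have [d|tau [Hfix Hfr]] := @perm_fresh sg (Lt ++ R1)
  [seq d <- nseq_of e1 | d \notin Lt ++ R1] Ls.
  by rewrite mem_filter => /andP[].
pose e2 := perm_noms tau e1.
have ue2 : uniq (nseq_of e2) by rewrite uniq_perm_noms.
have Ht1 d : supp (app_subst r1 t) d -> perm_nom tau d = d.
  move=> /supp_app_subst[/HLt H|/HR1 H]; apply: Hfix; by rewrite mem_cat H ?orbT.
(* This is alpha-renaming: [tau] fixes the support of the body, hence also that of its
   abstraction. *)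
have {}He : conv (app_subst r1 s) (lam_noms e2 (app_subst r1 t)).
  apply: conv_trans He _.
  apply: conv_trans (conv_lam_noms _ (conv_perm_fix Ht1)).
  rewrite -perm_lam_noms; apply: conv_sym; apply: conv_perm_fix.
  by move=> d /supp_lam_noms[/Ht1].
(* An abstracted constant in the support of [s] cannot come from [r1], which avoids that support,
   nor can it be vacuous, since [tau] moved the vacuous ones away; so it lies in the support of
   [t]. *)
have He2 d : d \in nseq_of e2 -> d \in Ls ++ Lt -> d \in Lt.
  rewrite nseq_of_perm_noms => /mapP[x Hx ->].
  have [HxR|HxR] := boolP (x \in Lt ++ R1).
    rewrite (Hfix _ HxR); move: HxR; rewrite mem_cat => /orP[//|/HR1 Hx1].
    rewrite mem_cat => /orP[/HLs H|//].
    by case: (Hr1 x) => //; left.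
  have := Hfr x; rewrite mem_filter HxR Hx => /(_ isT) /negbTE H.
  by rewrite mem_cat H.
have cR d : d \in nseq_of c -> d \notin Ls ++ Lt.
  move=> /Hc H; apply/negP; rewrite mem_cat => /orP[/HLs|/HLt] H'; apply: H.
    by left.
  by right.
(* Abstracted constants in the supports of [s] and [t] stay put, and by [He2] are admissible choices
   from [t]; each remaining one becomes the [c] at its position. *)
have [pi1 [Hfix1 Hmap1]] := perm_extend_noms ue2 uc cR.
have fix_s d : supp s d -> perm_nom pi1 d = d.
  by move=> /HLs H; apply: Hfix1; rewrite mem_cat H.
have fix_t d : supp t d -> perm_nom pi1 d = d.
  by move=> /HLt H; apply: Hfix1; rewrite mem_cat H orbT.
exists (perm_subst pi1 r1), (perm_noms pi1 e2); split.
- exact: approx_trans (approx_perm pi' rh) (approx_perm pi1 r1).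
- split; first by rewrite uniq_perm_noms.
  move=> d; rewrite nseq_of_perm_noms => /mapP[x Hx ->].
  have [HxR|HxR] := boolP (x \in Ls ++ Lt).
    by left; rewrite Hfix1 //; apply/HLt; apply: He2.
  right; have sz (z : noms ts) : size (nseq_of z) = size ts.
    by rewrite -{2}(map_tag_nseq_of z) size_map.
  move: Hx HxR => /(nthP x)[i]; rewrite sz => Hi <- HxR.
  by rewrite Hmap1 //; apply: mem_nth; rewrite sz.
- have := conv_perm pi1 He; rewrite perm_lam_noms !perm_term_subst => H.
  apply: conv_trans (conv_app_subst _ (conv_sym (conv_perm_fix fix_s))) _.
  apply: conv_trans H _; apply: conv_lam_noms.
  exact: conv_app_subst (conv_perm_fix fix_t).
- move=> d Hd /subst_supp_perm[x Hx E]; apply: (Hr1 d Hd).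
  have Efix : perm_nom pi1 d = d by case: Hd; [apply: fix_s|apply: fix_t].
  by move: E; rewrite -{1}Efix => /perm_nom_inj ->.
Qed.

(** On [h] in [Sigma], [raise_subst] followed by [rh] yields the abstraction of [th h] over [c],
    applied to [c], which beta-reduces to [th h]. The equation for [th] thus becomes one for
    [rh]. *)
Lemma raised_unifier (ts bs : seq (sty sg)) (t0 : sty sg)
    (s : term (sg := sg) (arrs ts t0)) (t : term t0) (Sigma : seq (anyvar sg))
    (pr : raising ts) (c a : noms ts) (b : noms bs) rh th :
  (forall x, nabs_fv (NAbs s t) x -> x \in Sigma) ->
  (forall u (h : var u), mkvar h \in Sigma ->
     rh _ (pr u h) = lam_noms c (th u h)) ->
  (forall d, subst_supp rh d -> subst_supp th d /\ d \notin nseq_of c) ->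
  (forall d, nabs_supp (NAbs s t) d -> ~ subst_supp th d) ->
  (forall d, d \in nseq_of a ++ nseq_of b ->
     nabs_supp (NAbs s t) d \/ d \in nseq_of c) ->
  conv (app_subst th s) (lam_noms a (app_subst th t)) ->
  is_unifier (lam_noms b (app_subst (raise_subst Sigma pr c) s))
    (lam_noms b (lam_noms a (app_subst (raise_subst Sigma pr c) t))) rh.
Proof.
move=> Hfv Hrh Hsupp Hth Hab Hconv.
(* This yields both the commutation of [rh] with the abstractions over [a] and [b] and the side
   condition on unifiers. *)
have avoid d : nabs_supp (NAbs s t) d \/ d \in nseq_of c -> ~ subst_supp rh d.
  move=> Hd /Hsupp[H1 /negP H2]; case: Hd => // Hd; exact: Hth H1.
have act u (m : term u) : (forall x, fv m x -> x \in Sigma) ->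
    conv (app_subst rh (app_subst (raise_subst Sigma pr c) m)) (app_subst th m).
  move=> Hm; rewrite app_subst_comp; apply: conv_app_subst_fv => v h /Hm Hh /=.
  by rewrite Hh app_subst_app_noms /app_subst /= Hrh //; apply: app_lam_noms.
have act_s := act _ s (fun x Hx => Hfv x (or_introl Hx)).
have act_t := act _ t (fun x Hx => Hfv x (or_intror Hx)).
have Ha d : d \in nseq_of a -> ~ subst_supp rh d.
  by move=> H; apply: avoid; apply: Hab; rewrite mem_cat H.
have Hb d : d \in nseq_of b -> ~ subst_supp rh d.
  by move=> H; apply: avoid; apply: Hab; rewrite mem_cat H orbT.
split.
  apply: conv_trans (app_subst_lam_noms _ Hb) _.
  apply: conv_trans (conv_sym (app_subst_lam_noms _ Hb)).
  apply: conv_lam_noms; apply: conv_trans act_s _; apply: conv_trans Hconv _.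
  apply: conv_trans (conv_lam_noms _ (conv_sym act_t)) _.
  exact: conv_sym (app_subst_lam_noms _ Ha).
move=> d Hd; apply: avoid.
case: Hd => [/supp_lam_noms[]|/supp_lam_noms[/supp_lam_noms[]]] /supp_app_subst[];
  try by move=> /raise_subst_supp; auto.
- by left; left.
- by left; right.
Qed.

(** On [h] in [Sigma], [ch h] is [rh0] at [h'] applied to a renaming of [c]. A further renaming
    turns this into the [pi3]-image of that value applied to a fresh vector [e]. Then [si] and [pi4]
    carry the function part to [rh] at [h'], and renaming the arguments back to [c] leaves [th h]
    after beta. *)
Lemma less_general_raise (ts : seq (sty sg)) (Sigma : seq (anyvar sg))
    (pr : raising ts) (c : noms ts) rh rh0 th ch :
  uniq (nseq_of c) ->
  (forall u (h : var u), mkvar h \in Sigma ->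
     rh _ (pr u h) = lam_noms c (th u h)) ->
  (forall d, d \in nseq_of c -> ~ subst_supp rh d) ->
  less_general rh rh0 -> is_ncomp (raise_subst Sigma pr c) rh0 ch ->
  less_general_on Sigma th ch.
Proof.
move=> uc Hrh Hc [si [ch0 [[pi3 [Hpi3 Hch0]] [pi4 Hpi4]]]].
case/(is_ncomp_fresh (nseq_of c)) => pi5 [Hpi5 Hch].
have [pi4' [K4 _]] := perm_inv_ex pi4.
have [R3 HR3] := subst_supp_finite (perm_subst pi3 rh0).
have [Rsi HRsi] := subst_supp_finite si; have [Rr HRr] := subst_supp_finite rh.
(* The vector [e] avoids the renamed [rh0] so that arguments can be moved without touching it, [si]
   so that the nominal composition is legitimate, and the preimage of the support of [rh] under
   [pi4] so that its [pi4]-image can be renamed to [c] with [rh] fixed. *)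
have [//|tau0 [_ Htau0]] := @perm_fresh sg [::] (nseq_of c)
  (R3 ++ Rsi ++ map (perm_nom pi4') Rr).
pose e := perm_noms tau0 c.
have ue : uniq (nseq_of e) by rewrite uniq_perm_noms.
have He d : d \in nseq_of e ->
    [/\ d \notin R3, d \notin Rsi & perm_nom pi4 d \notin Rr].
  rewrite nseq_of_perm_noms => /mapP[x /Htau0 Hx ->]; move: Hx.
  rewrite !mem_cat !negb_or => /and3P[H1 H2 H3]; split=> //.
  apply: contra H3 => H; apply/mapP; exists (perm_nom pi4 (perm_nom tau0 x)) => //.
  by rewrite {2}/perm_nom /= K4.
(* With [pi3] alone the arguments of [ch h] could collide with [si]; [tau6] moves them to [e] and
   fixes the renamed [rh0]. *)
have [|||d|tau6 [Hfix6 Hmap6]] := @perm_map_noms sg R3 ts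
    (perm_noms pi3 (perm_noms pi5 c)) e; rewrite ?uniq_perm_noms //.
- move=> d; rewrite !nseq_of_perm_noms => /mapP[x /mapP[y Hy ->] ->].
  apply/negP => /HR3 /subst_supp_perm[z Hz /perm_nom_inj E].
  by apply: (Hpi5 _ Hy); rewrite E.
- by case/He.
have [|||d|tau7 [Hfix7 Hmap7]] := @perm_map_noms sg Rr ts (perm_noms pi4 e) c;
    rewrite ?uniq_perm_noms //.
- by move=> d; rewrite nseq_of_perm_noms => /mapP[x /He[_ _ ?] ->].
- by move=> /Hc H; apply/negP => /HRr.
pose pi6 := perm_comp tau6 pi3.
have key u (h : var u) : mkvar h \in Sigma -> conv (perm_term pi6 (ch u h))
    (app_noms (perm_term pi3 (rh0 _ (pr u h))) e).
  move=> Hh; apply: conv_trans (conv_perm pi6 (Hch u h)) _ => /=.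
  rewrite Hh perm_app_noms app_subst_app_noms perm_app_noms.
  rewrite perm_noms_comp Hmap6; apply: conv_app_noms.
  rewrite -perm_term_comp; apply: conv_perm_fix => d Hd.
  by apply: Hfix6; apply/HR3; exists _, (pr u h).
exists si, (Defs.comp (perm_subst pi6 (restrict Sigma ch)) si); split.
  exists pi6; split=> [d [u [h]] /=|]; last exact: subst_eq_refl.
  case: ifP => [Hh|_ /supp_Fv//] Hd.
  have /supp_app_noms[H|/He[_ /negP H _]] := supp_conv (key u h Hh) Hd.
    by apply: Hpi3; exists _, (pr u h).
  by move=> /HRsi.
exists (perm_comp tau7 pi4) => u h /=; case: ifP => [Hh|_]; last exact: conv_refl.
apply: conv_sym; rewrite -perm_term_comp.
apply: conv_trans (conv_perm _ (conv_perm _ (conv_app_subst _ (key u h Hh)))) _.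
rewrite app_subst_app_noms !perm_app_noms Hmap7.
apply: conv_trans (app_lam_noms c (th u h)); apply: conv_app_noms.
rewrite -Hrh //.
have step : conv (perm_term pi4 (app_subst si (perm_term pi3 (rh0 _ (pr u h)))))
    (rh _ (pr u h)).
  apply: conv_sym; apply: conv_trans (Hpi4 _ _) _.
  exact: conv_perm (Hch0 _ _).
apply: conv_trans (conv_perm _ step) _; apply: conv_perm_fix => d Hd.
by apply: Hfix7; apply/HRr; exists _, (pr u h).
Qed.

End Solutions.

Theorem theorem2 (sg : signature)
    (CSU : forall u : sty sg, term u -> term u -> subst sg -> Prop)
    (CSU_ok : forall (u : sty sg) (m1 m2 : term u), is_csu m1 m2 (CSU u m1 m2))
    (bullet : subst sg -> subst sg -> subst sg)
    (bullet_ok : forall th rh : subst sg, is_ncomp th rh (bullet th rh))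
    (taus : seq (sty sg)) (tau : sty sg)
    (s : term (sg := sg) (arrs taus tau)) (t : term tau)
    (Sigma : seq (anyvar sg))
    (fv_Sigma : forall x : anyvar sg, nabs_fv (NAbs s t) x -> x \in Sigma)
    (c : noms taus)
    (c_distinct : uniq (nseq_of c))
    (c_fresh : forall d : anynom sg,
       d \in nseq_of c -> ~ nabs_supp (NAbs s t) d)
    (pr : raising taus)
    (pr_ok : raising_ok Sigma pr)
    (lst : noms taus -> {bs : seq (sty sg) & noms bs})
    (lst_ok : listings_ok t (app_subst (raise_subst Sigma pr c) s)
                (app_subst (raise_subst Sigma pr c) t) c lst) :
  is_csnas Sigma (NAbs s t) (solution_set CSU bullet Sigma s t c pr lst).
Proof.
split=> [th [rh [[a [Hsel HCSU]] Heq]]|rh Hrh].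
  have [Huni _] := CSU_ok _ (lam_noms (projT2 (lst a))
    (app_subst (raise_subst Sigma pr c) s)) (lam_noms (projT2 (lst a))
    (lam_noms a (app_subst (raise_subst Sigma pr c) t))).
  apply: solution_of_unifier (Huni _ HCSU) _; first by case: Hsel.
    by move=> d /raise_subst_supp; apply: c_fresh.
  have [pi [H1 H2]] := bullet_ok (raise_subst Sigma pr c) rh.
  by exists pi; split=> // u x; apply: conv_trans (Heq u x) (H2 u x).
have [th [a [Happ Hsel Hconv Hfresh]]] := solution_selection c_distinct c_fresh Hrh.
have [rh1 [Hrh1 Hsupp1]] :=
  raised_subst_ex (fun u h => lam_noms c (th u h)) (proj1 pr_ok).
have {}Hsupp1 d : subst_supp rh1 d -> subst_supp th d /\ d \notin nseq_of c.
  by move=> /Hsupp1[u [h /supp_lam_noms[Hd ?]]]; split=> //; exists u, h.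
have Hunif : is_unifier
    (lam_noms (projT2 (lst a)) (app_subst (raise_subst Sigma pr c) s))
    (lam_noms (projT2 (lst a))
       (lam_noms a (app_subst (raise_subst Sigma pr c) t))) rh1.
  (* The raising substitution introduces only the constants [c], so a listing of constants of the
     raised terms stays within the original support and [c]. *)
  apply: (raised_unifier (th := th)) => // d; rewrite mem_cat => /orP[].
    by case: Hsel => _ H /H[]; [left; right|right].
  have [_ Hl] := lst_ok a Hsel; move=> /Hl[[] /supp_app_subst[] H _].
  - by left; left.
  - by right; apply: raise_subst_supp H.
  - by left; right.
  - by right; apply: raise_subst_supp H.
have [_ /(_ _ Hunif)[rh0 Hrh0 Hless]] := CSU_ok _ (lam_noms (projT2 (lst a))
    (app_subst (raise_subst Sigma pr c) s)) (lam_noms (projT2 (lst a))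
    (lam_noms a (app_subst (raise_subst Sigma pr c) t))).
exists (bullet (raise_subst Sigma pr c) rh0).
  exists rh0; split; last exact: subst_eq_refl.
  by exists a.
have Hc d : d \in nseq_of c -> ~ subst_supp rh1 d.
  by move=> Hd /Hsupp1[_]; rewrite Hd.
have [si [ch [H1 H2]]] := less_general_raise c_distinct Hrh1 Hc Hless
  (bullet_ok (raise_subst Sigma pr c) rh0).
exists si, ch; split=> //.
exact: approx_trans (approx_restrict Sigma Happ) H2.
Qed.
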